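(* Let $\Theta, B$ be finite Blaschke products with $\deg B<\deg\Theta$. Let $\Theta$ be unicritical with $\deg\Theta$ equal to $3$ or $4$. Then $$\max\{|B(z)| : z\in W(S_\Theta)\}\ge\tfrac12.$$
   Context: $\mathbb{D}$ is the open unit disk and $\mathbb{T}$ the unit circle. A finite Blaschke product of degree $n$ is a function $\lambda \prod_{j=1}^n \frac{z-a_j}{1-\bar{a}_j z}$ with $a_1,\dots,a_n\in\mathbb{D}$ (not necessarily distinct) and $\lambda\in\mathbb{T}$. It is unicritical if it has the form $\lambda\left(\frac{z-z_0}{1-\bar z_0 z}\right)^n$ with $z_0\in\mathbb{D}$, $n\ge1$, $\lambda\in\mathbb{T}$. For a finite Blaschke product $\Theta$, $K_\Theta = H^2\ominus \Theta H^2$, where $H^2=H^2(\mathbb{D})$ is the Hardy space; $\dim K_\Theta = \deg\Theta$. The compression of the shift is $S_\Theta = P_\Theta M_z|_{K_\Theta}$, where $P_\Theta$ is the orthogonal projection of $H^2$ onto $K_\Theta$ and $M_z$ is multiplication by $z$. The numerical range of an operator $A$ is $W(A)=\{\langle Ax,x\rangle : \|x\|=1\}$. *)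

(* Defs.v *)
From HB Require Import structures.
From mathcomp Require Import all_boot all_order all_algebra.
From mathcomp Require Import complex.
From mathcomp Require Import all_classical all_reals all_analysis.
Set Implicit Arguments.
Unset Strict Implicit.
Unset Printing Implicit Defensive.
Import Order.TTheory GRing.Theory Num.Theory.
Import numFieldNormedType.Exports.
Local Open Scope classical_set_scope.
Local Open Scope ring_scope.
Local Open Scope complex_scope.

(* The topology of R[i] given by its modulus, as for any numClosedFieldType. *)
HB.instance Definition _ (R : rcfType) := NormedModule.copy R[i] R[i]^o.

Record finite_blaschke (R : realType) := FiniteBlaschke {
  fb_const : R[i];
  fb_zeros : seq R[i];
  fb_constP : `|fb_const| = 1;
  fb_zerosP : forall a, a \in fb_zeros -> `|a| < 1 }.

Definition moebius (R : realType) (a z : R[i]) : R[i] :=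
  (z - a) / (1 - Num.conj a * z).

(* Total on the complex plane; only the values on the closed unit disk, where
   no denominator vanishes, are meaningful. *)
Definition fb_fun (R : realType) (b : finite_blaschke R) (z : R[i]) : R[i] :=
  fb_const b * \prod_(a <- fb_zeros b) moebius a z.

Coercion fb_fun : finite_blaschke >-> Funclass.

Definition fb_deg (R : realType) (b : finite_blaschke R) : nat :=
  size (fb_zeros b).

(* The exponent in this form is necessarily the degree. *)
Definition unicritical (R : realType) (b : finite_blaschke R) : Prop :=
  (1 <= fb_deg b)%N /\
  exists l z0 : R[i], [/\ `|l| = 1, `|z0| < 1 &
    forall z, `|z| < 1 -> b z = l * moebius z0 z ^+ fb_deg b].

Definition disk (R : realType) := {z : R[i] | `|z| < 1}.

Definition is_taylor (R : realType) (f : disk R -> R[i]) (a : nat -> R[i]) :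
    Prop :=
  forall z : disk R, series (fun n => a n * val z ^+ n) @ \oo --> f z.

(* The Hardy space: holomorphic functions on the disk with square-summable
   Taylor coefficients at 0. *)
Definition hardy (R : realType) : set (disk R -> R[i]) :=
  [set f | exists a, is_taylor f a /\ cvgn (series (fun n => `|a n| ^+ 2))].

(* Taylor coefficients at 0, which are unique when they exist. *)
Definition taylor (R : realType) (f : disk R -> R[i]) : nat -> R[i] :=
  xget (fun=> 0) [set a | is_taylor f a].

(* Linear in the first argument; meaningful for f and g in hardy R. *)
Definition hdot (R : realType) (f g : disk R -> R[i]) : R[i] :=
  limn (series (fun n => taylor f n * Num.conj (taylor g n))).

Definition hnorm (R : realType) (f : disk R -> R[i]) : R[i] :=
  sqrtC (hdot f f).

Definition fmul (R : realType) (u : R[i] -> R[i]) (f : disk R -> R[i]) :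
    disk R -> R[i] :=
  fun z => u (val z) * f z.

Definition orth_compl (R : realType) (E : set (disk R -> R[i])) :
    set (disk R -> R[i]) :=
  [set f | hardy f /\ forall g, E g -> hdot f g = 0].

(* Orthogonal projection onto K: the g in K with f - g orthogonal to K. *)
Definition orth_proj (R : realType) (K : set (disk R -> R[i]))
    (f : disk R -> R[i]) : disk R -> R[i] :=
  xget (fun=> 0) [set g | K g /\ orth_compl K (f \- g)].

Definition model_space (R : realType) (Theta : finite_blaschke R) :
    set (disk R -> R[i]) :=
  orth_compl (fmul Theta @` @hardy R).

(* To be applied to elements of model_space Theta. *)
Definition compressed_shift (R : realType) (Theta : finite_blaschke R)
    (f : disk R -> R[i]) : disk R -> R[i] :=
  orth_proj (model_space Theta) (fmul id f).

(* Numerical range of an operator A on the subspace K of the Hardy space. *)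
Definition numerical_range (R : realType) (K : set (disk R -> R[i]))
    (A : (disk R -> R[i]) -> disk R -> R[i]) : set R[i] :=
  [set hdot (A f) f | f in [set f | K f /\ hnorm f = 1]].

(* On R[i], x <= y means that y - x is a nonnegative real number; this is meant
   for sets of moduli, where it is the usual order. *)
Definition is_max (R : realType) (E : set R[i]) (m : R[i]) : Prop :=
  E m /\ forall x, E x -> x <= m.

(* Main.v *)
Require Import Defs.
From HB Require Import structures.
From mathcomp Require Import all_boot all_order all_algebra.
From mathcomp Require Import complex ring lra.
From mathcomp Require Import all_classical all_reals all_analysis.
Set Implicit Arguments.
Unset Strict Implicit.
Unset Printing Implicit Defensive.
Import Order.TTheory GRing.Theory Num.Theory.
Import numFieldNormedType.Exports.
Local Open Scope classical_set_scope.
Local Open Scope ring_scope.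

(** Let [Theta = l * moebius c ^+ n]. In an orthonormal basis of the model space adapted to
    [c] the compressed shift has an explicit triangular Toeplitz matrix, so its numerical
    range is compact, and it is convex by the Toeplitz-Hausdorff theorem. An explicit trial
    vector in each direction shows that it contains a pseudohyperbolic disk, with center a
    real multiple of [c] and radius [r = 1 / sqrt 2] if [n = 3], [r = 27 / 34] if [n = 4].
    On the boundary of such a disk a Blaschke product of degree [m] has modulus at least
    [r ^+ m] somewhere: in a coordinate [w] with [|w| = r], its modulus equals that of an
    analytic function of modulus [r ^+ m] at [0]. Finally [r ^+ (n - 1) >= 1 / 2]. *)

(** * A lower bound for Blaschke products *)

(** The constants are dictated by [c = 0], where the compressed shift is a nilpotent Jordan block:
    its numerical range is the disk of radius [cos (pi / (n + 1))] about [0], and [B = z ^+ (n - 1)]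
    has maximum [cos (pi / (n + 1)) ^+ (n - 1)] there. For [n = 3] this is exactly [1 / 2], so there
    is no slack and [r] is forced. For [n = 4] any [r] between [2 ^ (-1/3)], about [0.7937], and
    [cos (pi / 5)], about [0.8090], is conceivable; [27 / 34], about [0.7941], is rational, which
    turns the estimates into polynomial inequalities with rational coefficients. As [|c|] tends to
    [1] the numerical range shrinks to a point, so no euclidean radius works uniformly; a
    pseudohyperbolic one does. The eigenvectors of the real part of the rotated matrix are not
    explicit for [c != 0], and approximate ones are enough: a lower bound for the support function
    of a compact convex set in every direction already yields the disk. *)

Lemma conjDE (C : numClosedFieldType) (x y : C) : (x + y)^* = x^* + y^*.
Proof. exact: rmorphD. Qed.
Lemma conjNE (C : numClosedFieldType) (x : C) : (- x)^* = - x^*.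
Proof. exact: rmorphN. Qed.
Lemma conjME (C : numClosedFieldType) (x y : C) : (x * y)^* = x^* * y^*.
Proof. exact: rmorphM. Qed.
Lemma conjVE (C : numClosedFieldType) (x : C) : (x^-1)^* = (x^*)^-1.
Proof. exact: fmorphV. Qed.
Lemma conj1E (C : numClosedFieldType) : (1 : C)^* = 1.
Proof. exact: rmorph1. Qed.
Lemma conj0E (C : numClosedFieldType) : (0 : C)^* = 0.
Proof. exact: rmorph0. Qed.
Definition conjE := (conjDE, conjNE, conjME, conjVE, conj1E, conj0E).

(** A maximum principle at the centre without integration: averaging over the two square roots of
    [v] leaves the even part of [G] at [v], which keeps the value at [0], roughly halves the size
    and replaces [r] by [r ^+ 2]. *)
Lemma poly_mean_bound (C : numClosedFieldType) (G : {poly C}) (r M : C) :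
  0 <= r -> (forall w, `|w| = r -> `|G.[w]| <= M) -> `|G.[0]| <= M.
Proof.
move: {2}(size G) (leqnn (size G)) => n; elim/ltn_ind: n G r => n IHn G r sG r0 hG.
have [s1|s1] := leqP (size G) 1.
  by rewrite (size1_polyC s1) hornerC in hG *; have := hG r (ger0_norm r0); rewrite hornerC.
have -> : G.[0] = (even_poly G).[0] by rewrite !horner_coef0 coef_even_poly.
have ltn : ((uphalf (size G)) < n)%N.
  apply: leq_trans sG; move: (size G) s1 => [|[|k]] // _.
  by rewrite /= !ltnS uphalf_half -[leqRHS]odd_double_half leq_add2l -addnn leq_addr.
apply: (IHn _ ltn _ (r ^+ 2)) => [||v vr]; rewrite ?size_even_poly ?exprn_ge0 //.
have nw : `|sqrtC v| = r by apply/(pexpIrn (n := 2)); rewrite ?nnegrE // -normrX sqrtCK.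
have hw : forall w, w ^+ 2 = v -> G.[w] = (even_poly G).[v] + (odd_poly G).[v] * w.
  by move=> w <-; rewrite -{1}(poly_even_odd G) hornerD hornerM !horner_comp !hornerE.
have := hG (- sqrtC v); have := hG (sqrtC v); rewrite normrN nw => /(_ erefl) h1 /(_ erefl) h2.
rewrite !hw ?sqrrN ?sqrtCK // in h1 h2.
have -> : (even_poly G).[v] = ((even_poly G).[v] + (odd_poly G).[v] * sqrtC v +
   ((even_poly G).[v] + (odd_poly G).[v] * - sqrtC v)) / 2 by field.
rewrite normrM normfV normr_nat ler_pdivrMr ?ltr0n // mulr_natr mulr2n.
by apply: le_trans (ler_normD _ _) _; exact: lerD.
Qed.

Lemma moebius_norm_lt1 (C : numClosedFieldType) (a p : C) :
  `|a| < 1 -> `|p| < 1 -> `|(a - p) / (1 - p^* * a)| < 1.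
Proof.
move=> a1 p1.
have pa : `|p^* * a| < 1 by rewrite normrM norm_conjC mulr_ilt1.
have nz : 0 < `|1 - p^* * a|.
  by rewrite normr_gt0 subr_eq0; apply: contraL pa => /eqP <-; rewrite normr1 ltxx.
rewrite normrM normfV ltr_pdivrMr // mul1r -(ltr_pXn2r (n := 2)) ?nnegrE //.
rewrite -subr_gt0 !normCK !conjE conjCK.
have -> : (1 - p^* * a) * (1 - p * a^*) - (a - p) * (a^* - p^*) =
    (1 - `|a| ^+ 2) * (1 - `|p| ^+ 2) by rewrite !normCK; ring.
by rewrite mulr_gt0 // subr_gt0 exprn_ilt1.
Qed.

(** In the coordinate [w] a Möbius factor remains one up to a unimodular constant, because
    [1 - p^* * a] and [1 - p * a^*] are conjugate. *)
Lemma moebius_norm_comp (C : numClosedFieldType) (a p w : C) :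
  `|a| < 1 -> `|p| < 1 -> `|w| < 1 ->
  let b := (a - p) / (1 - p^* * a) in
  let z := (w + p) / (1 + p^* * w) in
  `|(z - a) / (1 - a^* * z)| = `|(w - b) / (1 - b^* * w)|.
Proof.
move=> a1 p1 w1 b z.
have nz : forall u v : C, `|u| < 1 -> `|v| < 1 -> 1 - u * v != 0.
  move=> u v u1 v1; rewrite subr_eq0; apply: contraL (mulr_ilt1 (normr_ge0 u) (normr_ge0 v) u1 v1).
  by move=> /eqP h; rewrite -normrM -h normr1 ltxx.
have h1 : 1 - p^* * a != 0 by rewrite nz ?norm_conjC.
have h2 : 1 + p^* * w != 0 by rewrite -[p^*]opprK mulNr nz ?normrN ?norm_conjC.
have h3 : 1 - p * a^* != 0 by rewrite nz ?norm_conjC.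
have eb : b^* = (a^* - p^*) / (1 - p * a^*).
  by rewrite /b !conjE conjCK.
have -> : z - a = (1 - p^* * a) * (w - b) / (1 + p^* * w).
  by rewrite /z /b; field; rewrite h1 h2.
have -> : 1 - a^* * z = (1 - p * a^*) * (1 - b^* * w) / (1 + p^* * w).
  by rewrite /z eb; field; rewrite h3 h2.
have e : `|1 - p * a^*| = `|1 - p^* * a|.
  by rewrite -(norm_conjC (1 - p * a^*)) !conjE conjCK mulrC.
rewrite !(normrM, normfV) e; have n1 : `|1 - p^* * a| != 0 by rewrite normr_eq0.
have n2 : `|1 + p^* * w| != 0 by rewrite normr_eq0.
(* This factor cannot vanish, as [|b| < 1]; with [0^-1 = 0] the identity holds in that case
   anyway. *)
have [->|n3] := eqVneq (`|1 - b^* * w|) 0; first by rewrite !(mulr0, mul0r, invr0).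
by field; rewrite n1 n2 n3.
Qed.

(* On [|w| = r], [|w - b| = |r - b^* w / r|], and the right-hand side extends to a
   function without zeros or poles whose value at [0] is [r]. *)
Lemma blaschke_circle_bound (C : numClosedFieldType) (s : seq C) (r M : C) :
  (forall b, b \in s -> `|b| < 1) -> 0 < r < 1 ->
  (forall w, `|w| = r -> \prod_(b <- s) `|(w - b) / (1 - b^* * w)| <= M) ->
  forall L, r ^+ size s <= M * (1 + r ^+ L.+1) ^+ size s.
Proof.
move=> s1 /andP[r0 r1] hM L.
(* The inverse of [1 - b^* w] is replaced by a partial sum of its geometric series to make [G] a
   polynomial; the truncation costs the factor [1 + r ^+ L.+1]. *)
pose G : {poly C} := \prod_(b <- s) ((r%:P - (b^* / r) *: 'X) * \sum_(l < L.+1) (b^* *: 'X) ^+ l).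
have -> : r ^+ size s = `|G.[0]|.
  rewrite horner_prod.
  transitivity (`|\prod_(b <- s) r|).
    by rewrite big_const_seq count_predT iter_mulr_1 ger0_norm // exprn_ge0 // ltW.
  congr `|_|; apply: eq_bigr => b _.
  rewrite hornerM !hornerE horner_sum big_ord_recl big1 => [|i _];
    rewrite !hornerE ?expr0n ?mulr0 ?oppr0 ?addr0 ?mulr1 //=.
apply: (@poly_mean_bound _ _ r) => [|w wr]; first exact: ltW.
rewrite horner_prod normr_prod.
have -> : (1 + r ^+ L.+1) ^+ size s = \prod_(b <- s) (1 + r ^+ L.+1).
  by rewrite big_const_seq count_predT iter_mulr_1.
apply: le_trans (_ : \prod_(b <- s) (`|(w - b) / (1 - b^* * w)| * (1 + r ^+ L.+1)) <= _);
  last first.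
  rewrite big_split /= ler_wpM2r ?hM // prodr_ge0 // => i _.
  by rewrite addr_ge0 ?exprn_ge0 ?ltW.
rewrite big_seq [leRHS]big_seq; apply: ler_prod => b bs; rewrite normr_ge0 /=.
have b1 := s1 b bs.
have nz : 1 - b^* * w != 0.
  rewrite subr_eq0; apply: contraL (mulr_ilt1 (normr_ge0 b) (normr_ge0 w) b1 _); last by rewrite wr.
  by move=> /eqP h; rewrite -norm_conjC -normrM -h normr1 ltxx.
have e1 : (\sum_(l < L.+1) (b^* *: 'X) ^+ l).[w] = (1 - (b^* * w) ^+ L.+1) / (1 - b^* * w).
  apply: (mulfI nz); rewrite mulrCA mulfV // mulr1.
  rewrite -[RHS]opprB subrX1 -[1 - b^* * w in LHS]opprB mulNr horner_sum.
  by congr (- (_ * _)); apply: eq_bigr => i _; rewrite horner_exp !hornerE.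
rewrite hornerM e1 !hornerE !(normrM, normfV).
have w0 : w != 0 by rewrite -normr_gt0 wr.
(* On the circle [w * w^* = r ^+ 2], so this factor has the modulus of [w - b]. *)
have -> : r - b^* / r * w = w / r * (w - b)^*.
  have r2 : r = w * w^* / r by rewrite -normCK wr expr2 mulfK // gt_eqF.
  by rewrite {1}r2 !conjE; field; rewrite gt_eqF.
rewrite !normrM normfV wr (ger0_norm (ltW r0)) divff ?gt_eqF // mul1r norm_conjC.
rewrite [leRHS]mulrAC ler_wpM2r ?invr_ge0 // ler_wpM2l //.
apply: le_trans (ler_normB _ _) _; rewrite normr1 normrX normrM norm_conjC wr lerD2l.
by apply: lerXn2r; rewrite ?nnegrE ?mulr_ge0 ?(ltW r0) // ler_piMl // ltW.
Qed.

(** The truncation order [L] goes to infinity. Since [M] dominates a product of moduli it is real,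
    and the limit can be taken in [R]. *)
Lemma blaschke_pseudodisk_bound (R : realType) (s : seq R[i]) (p M : R[i]) (r : R) :
  (forall a, a \in s -> `|a| < 1) -> `|p| < 1 -> 0 < r < 1 ->
  (forall w, `|w| = r%:C%C ->
     \prod_(a <- s) `|moebius a ((w + p) / (1 + p^* * w))| <= M) ->
  (r ^+ size s)%:C%C <= M.
Proof.
move=> s1 p1 /andP[r0 r1] hM.
pose t := [seq (a - p) / (1 - p^* * a) | a <- s].
have rC : 0 < r%:C%C < 1 by rewrite -[0]/(0%:C%C) -[1]/(1%:C%C) !ltcR r0.
have t1 b : b \in t -> `|b| < 1.
  by case/mapP => a /s1 a1 ->; exact: moebius_norm_lt1.
have /(blaschke_circle_bound t1 rC) : forall w, `|w| = r%:C%C ->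
    \prod_(b <- t) `|(w - b) / (1 - b^* * w)| <= M.
  move=> w wr; apply: le_trans (hM w wr); rewrite big_map le_eqVlt; apply/orP; left; apply/eqP.
  rewrite big_seq [RHS]big_seq; apply: eq_bigr => a /s1 a1.
  by rewrite /moebius moebius_norm_comp // wr; case/andP: rC.
rewrite size_map => hL.
have M0 : 0 <= M.
  by apply: le_trans (hM r%:C%C _); rewrite ?prodr_ge0 // ger0_norm // ltW //; case/andP: rC.
have [m Mm] := complex_realP _ (ger0_real M0); rewrite {}Mm in hL *.
rewrite lecR.
have {}hL L : r ^+ size s <= m * (1 + r ^+ L.+1) ^+ size s.
  by rewrite -lecR rmorphM !rmorphXn rmorphD rmorph1 rmorphXn.
have cv : (fun L => m * (1 + r ^+ L.+1) ^+ size s) @ \oo --> m.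
  rewrite -[X in _ --> X](_ : m * (1 + 0) ^+ size s = m); last by rewrite addr0 expr1n mulr1.
  apply: cvgM; first exact: cvg_cst.
  apply: (@continuous_cvg _ _ _ _ _ (fun L => 1 + r ^+ L.+1) (fun x : R => x ^+ size s)).
    exact: exprn_continuous.
  apply: cvgD; first exact: cvg_cst.
  rewrite (_ : (fun L => r ^+ L.+1) = [sequence r ^+ L.+1]_L) // cvg_shiftS.
  by apply: cvg_expr; rewrite ger0_norm // ltW.
rewrite -(cvg_lim _ cv) //; apply: limr_ge; first by apply/cvg_ex; exists m.
by near=> L.
Unshelve. all: by end_near.
Qed.

(** * Sequences of Taylor coefficients *)

Lemma norm_real_complex (R : rcfType) (x : R) : `|x%:C%C| = `|x|%:C%C.
Proof. by rewrite normc_def /= expr0n addr0 sqrtr_sqr. Qed.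

Lemma cvg_real_complex (R : realType) (u : R ^nat) (l : R) :
  u @ \oo --> l -> (fun n => (u n)%:C%C) @ \oo --> l%:C%C.
Proof.
move=> /cvgrPdist_lt h; apply/cvgrPdist_lt => -[x y]; rewrite ltcE /= => /andP[/eqP -> x0].
near=> n; rewrite -rmorphB norm_real_complex ltcR.
by near: n; exact: h.
Unshelve. all: by end_near.
Qed.

Lemma cvg_conj (R : realType) (u : nat -> R[i]) (l : R[i]) :
  u @ \oo --> l -> (fun n => (u n)^*) @ \oo --> l^*.
Proof.
move=> /cvgrPdist_lt h; apply/cvgrPdist_lt => e e0.
near=> n; rewrite -rmorphB norm_conjC.
by near: n; exact: h.
Unshelve. all: by end_near.
Qed.

(** Elements of the model space turn out to have absolutely summable coefficients, which makes their
    inner products converge; of other elements of the Hardy space only bounded coefficients tending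
    to [0] are used. *)
Definition abs_summable (R : realType) (a : nat -> R[i]) : Prop :=
  exists M : R[i], forall N, \sum_(j < N) `|a j| <= M.

Definition seq_bounded (R : realType) (a : nat -> R[i]) : Prop :=
  exists2 M : R[i], 0 <= M & forall n, `|a n| <= M.

Lemma cvg_series_real_part (R : realType) (a : nat -> R[i]) (g : R[i] -> R) :
  (forall x, `|g x|%:C%C <= `|x|) -> abs_summable a -> cvgn (series (g \o a)).
Proof.
move=> hg [M hM]; apply: (@normed_cvg _ R); apply: nondecreasing_is_cvgn.
  by apply: nondecreasing_series => n _ _; exact: normr_ge0.
exists (complex.Re M) => _ [N _ <-].
change (\sum_(0 <= i < N) `|g (a i)| <= complex.Re M); rewrite big_mkord.
have M0 : 0 <= M by apply: le_trans (hM 0%N); rewrite big_ord0.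
rewrite -lecR (RRe_real (ger0_real M0)) rmorph_sum; apply: le_trans (hM N).
by apply: ler_sum => i _; exact: hg.
Qed.

Lemma abs_summable_cvg (R : realType) (a : nat -> R[i]) : abs_summable a -> cvgn (series a).
Proof.
move=> ha.
have hr := @cvg_series_real_part _ a (@complex.Re R) (@normc_ge_Re R) ha.
have hi : cvgn (series (@complex.Im R \o a)).
  apply: cvg_series_real_part => // x.
  rewrite -[`|x|](_ : `|x * 'i%C| = `|x|); last by rewrite normrM complexiE normCi mulr1.
  by rewrite -normrN -ReiNIm; exact: normc_ge_Re.
move/cvg_real_complex : hr => hr; move/cvg_real_complex : hi => hi.
apply/cvg_ex; exists ((limn (series (@complex.Re R \o a)))%:C%C +
  'i%C * (limn (series (@complex.Im R \o a)))%:C%C).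
rewrite (_ : series a = fun n => (series (@complex.Re R \o a) n)%:C%C +
  'i%C * (series (@complex.Im R \o a) n)%:C%C).
  by apply: cvgD; [exact: hr|apply: cvgM; [exact: cvg_cst|exact: hi]].
apply/funext => n; rewrite /series /= !rmorph_sum mulr_sumr -big_split /=.
by apply: eq_bigr => i _; exact: complexE.
Qed.

(* On Taylor coefficients, [seq_shift] is multiplication by [z] and [seq_back] its adjoint;
   [shift_sub c], [back_sub c] and [div_den c] are multiplication by [z - c], its adjoint,
   and division by [1 - c^* z]. *)
Definition seq_shift (R : realType) (a : nat -> R[i]) : nat -> R[i] :=
  fun n => if n is k.+1 then a k else 0.

Definition seq_back (R : realType) (a : nat -> R[i]) : nat -> R[i] := fun n => a n.+1.

Definition back_sub (R : realType) (c : R[i]) (a : nat -> R[i]) : nat -> R[i] :=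
  seq_back a - c^* *: a.

Definition shift_sub (R : realType) (c : R[i]) (a : nat -> R[i]) : nat -> R[i] :=
  seq_shift a - c *: a.

Fixpoint div_den (R : realType) (c : R[i]) (a : nat -> R[i]) (n : nat) : R[i] :=
  a n + (if n is k.+1 then c^* * div_den c a k else 0).

Section Sequences.
Variable R : realType.
Implicit Types (a b : nat -> R[i]) (c k : R[i]).

Lemma abs_summable_ge0 a M : (forall N, \sum_(j < N) `|a j| <= M) -> 0 <= M.
Proof. by move/(_ 0%N); rewrite big_ord0. Qed.

Lemma abs_summable_seq_bounded a : abs_summable a -> seq_bounded a.
Proof.
move=> [M hM]; exists M; first exact: abs_summable_ge0 hM.
move=> n; apply: le_trans (hM n.+1); rewrite big_ord_recr /= lerDr.
by rewrite sumr_ge0.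
Qed.

Lemma seq_boundedD a b : seq_bounded a -> seq_bounded b -> seq_bounded (a + b).
Proof.
move=> [M M0 hM] [N N0 hN]; exists (M + N) => [|n]; first exact: addr_ge0.
by apply: le_trans (ler_normD _ _) _; exact: lerD.
Qed.

Lemma seq_boundedZ k a : seq_bounded a -> seq_bounded (k *: a).
Proof.
move=> [M M0 hM]; exists (`|k| * M) => [|n]; first exact: mulr_ge0.
by rewrite normrM ler_wpM2l.
Qed.

Lemma seq_bounded_seq_shift a : seq_bounded a -> seq_bounded (seq_shift a).
Proof. by move=> [M M0 hM]; exists M => // -[|n] //=; rewrite normr0. Qed.

Lemma seq_bounded_shift_sub c a : seq_bounded a -> seq_bounded (shift_sub c a).
Proof.
by move=> ha; rewrite /shift_sub -scaleNr; apply: seq_boundedD;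
  [exact: seq_bounded_seq_shift|exact: seq_boundedZ].
Qed.

Lemma seq_bounded_div_den c a : `|c| < 1 -> seq_bounded a -> seq_bounded (div_den c a).
Proof.
move=> c1 [M M0 hM]; have c0 : 0 < 1 - `|c| by rewrite subr_gt0.
exists (M / (1 - `|c|)) => [|n]; first by rewrite divr_ge0 // ltW.
have MM : M <= M / (1 - `|c|) by rewrite ler_peMr // invf_ge1 // gerBl.
elim: n => [|n IHn] /=; first by rewrite addr0; exact: le_trans MM.
apply: le_trans (ler_normD _ _) _; rewrite normrM norm_conjC.
have -> : M / (1 - `|c|) = M + `|c| * (M / (1 - `|c|)) by field; rewrite gt_eqF.
by rewrite lerD // ler_wpM2l.
Qed.

Lemma abs_summableD a b : abs_summable a -> abs_summable b -> abs_summable (a + b).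
Proof.
move=> [M hM] [N hN]; exists (M + N) => n.
apply: le_trans (_ : \sum_(j < n) (`|a j| + `|b j|) <= _).
  by apply: ler_sum => j _; exact: ler_normD.
by rewrite big_split lerD.
Qed.

Lemma abs_summableM a b : abs_summable a -> seq_bounded b -> abs_summable (fun n => a n * b n).
Proof.
move=> [M hM] [N N0 hN]; exists (M * N) => n.
apply: le_trans (_ : \sum_(j < n) (`|a j| * N) <= _).
  by apply: ler_sum => j _; rewrite normrM ler_wpM2l.
by rewrite -mulr_suml ler_wpM2r.
Qed.

Lemma abs_summableZ k a : abs_summable a -> abs_summable (k *: a).
Proof.
move=> ha; rewrite (_ : k *: a = (fun n => a n * k)); last by apply/funext => n; exact: mulrC.
by apply: (@abs_summableM a (fun=> k)) => //; exists `|k|.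
Qed.

Lemma abs_summable_seq_back a : abs_summable a -> abs_summable (seq_back a).
Proof.
move=> [M hM]; exists M => n; apply: le_trans (hM n.+1).
by rewrite big_ord_recl lerDr.
Qed.

Lemma abs_summable_seq_shift a : abs_summable a -> abs_summable (seq_shift a).
Proof.
move=> [M hM]; exists M => -[|n]; first by rewrite big_ord0; exact: abs_summable_ge0 hM.
by rewrite big_ord_recl /= normr0 add0r; exact: hM.
Qed.

Lemma abs_summable_back_sub c a : abs_summable a -> abs_summable (back_sub c a).
Proof.
by move=> ha; rewrite /back_sub -scaleNr; apply: abs_summableD;
  [exact: abs_summable_seq_back|exact: abs_summableZ].
Qed.

Lemma abs_summable_shift_sub c a : abs_summable a -> abs_summable (shift_sub c a).
Proof.
by move=> ha; rewrite /shift_sub -scaleNr; apply: abs_summableD;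
  [exact: abs_summable_seq_shift|exact: abs_summableZ].
Qed.

(** Since [a n.+1 = back_sub c a n + c^* * a n], a partial sum of moduli is at most a constant plus
    [|c|] times itself, which is absorbed as [|c| < 1]. *)
Lemma abs_summable_back_sub_inv c a : `|c| < 1 -> abs_summable (back_sub c a) -> abs_summable a.
Proof.
move=> c1 [M hM]; have c0 : 0 < 1 - `|c| by rewrite subr_gt0.
exists ((`|a 0%N| + M) / (1 - `|c|)) => N.
rewrite ler_pdivlMr // mulrBr mulr1 lerBlDr.
case: N => [|N].
  by rewrite big_ord0 mul0r addr0 addr_ge0 //; exact: abs_summable_ge0 hM.
rewrite big_ord_recl -addrA lerD2l /=.
have hc : \sum_(j < N) `|a j| <= \sum_(j < N.+1) `|a j|.
  by rewrite big_ord_recr /= lerDl.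
apply: (@le_trans _ _ (\sum_(j < N) (`|back_sub c a j| + `|c| * `|a j|))).
  apply: ler_sum => j _; rewrite -[a (bump 0 j)](subrK (c^* * a j)).
  by apply: le_trans (ler_normD _ _) _; rewrite normrM norm_conjC.
rewrite big_split; apply: lerD; first exact: hM.
by rewrite -mulr_sumr mulrC ler_wpM2r //; move: hc; rewrite big_ord_recl.
Qed.

Lemma back_subE c a n : back_sub c a n = a n.+1 - c^* * a n. Proof. by []. Qed.

Lemma shift_subE c a n : shift_sub c a n = seq_shift a n - c * a n. Proof. by []. Qed.

Lemma back_sub_div_den c a : back_sub c (div_den c a) = seq_back a.
Proof. by apply/funext => n; rewrite back_subE /= addrK. Qed.

Lemma abs_summable_div_den c a : `|c| < 1 -> abs_summable a -> abs_summable (div_den c a).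
Proof. by move=> c1 ha; apply: (abs_summable_back_sub_inv c1); rewrite back_sub_div_den;
  exact: abs_summable_seq_back. Qed.

Lemma div_denK c a : div_den c a - c^* *: seq_shift (div_den c a) = a.
Proof.
apply/funext => n; transitivity (div_den c a n - c^* * seq_shift (div_den c a) n) => //.
by case: n => [|n] /=; rewrite ?mulr0 ?addrK // subr0 addr0.
Qed.

(* Summation by parts, with boundary term [- a N * (seq_shift b N)^*]. *)
Lemma cvg_shift_sub_back_sub c a b : a @ \oo --> 0 -> seq_bounded b ->
  (fun N => \sum_(0 <= j < N) a j * (shift_sub c b j)^* -
            \sum_(0 <= j < N) back_sub c a j * (b j)^*) @ \oo --> (0 : R[i]).
Proof.
move=> a0 hb.
rewrite (_ : (fun N => _) = fun N => - (a N * (seq_shift b N)^*)); last first.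
  apply/funext; elim => [|N IHN]; first by rewrite !big_nil /= !conj0E mulr0 subrr oppr0.
  rewrite !big_nat_recr //= opprD addrACA IHN back_subE shift_subE !conjE /=; ring.
have [M M0 hM] := seq_bounded_seq_shift hb.
apply/cvgr0Pnorm_lt => e e0.
have M1 : 0 < M + 1 by rewrite ltr_wpDl.
near=> N; rewrite normrN normrM norm_conjC.
apply: (@le_lt_trans _ _ (`|a N| * (M + 1))).
  by rewrite ler_wpM2l // (le_trans (hM N)) // lerDl.
rewrite -ltr_pdivlMr //; near: N.
by move/cvgr0Pnorm_lt : a0; apply; rewrite divr_gt0.
Unshelve. all: by end_near.
Qed.

Lemma cvg0_back_sub c a : a @ \oo --> (0 : R[i]) -> back_sub c a @ \oo --> (0 : R[i]).
Proof.
move=> a0; rewrite -[X in _ --> X](_ : 0 - c^* * 0 = 0 :> R[i]); last by rewrite mulr0 subr0.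
apply: cvgB; first by move: a0; rewrite -cvg_shiftS.
by apply: cvgM; [exact: cvg_cst|exact: a0].
Qed.

(** Iterated adjointness, stated for differences of partial sums: with [a] merely tending to [0] and
    [b] bounded, neither series need converge. *)
Lemma cvg_iter_shift_sub_back_sub c a b n : a @ \oo --> 0 -> seq_bounded b ->
  (fun N => \sum_(0 <= j < N) a j * (iter n (shift_sub c) b j)^* -
            \sum_(0 <= j < N) iter n (back_sub c) a j * (b j)^*) @ \oo --> (0 : R[i]).
Proof.
elim: n a b => [|n IHn] a b a0 hb.
  rewrite (_ : (fun N => _) = fun=> 0); first exact: cvg_cst.
  by apply/funext => N; rewrite subrr.
have h := IHn _ _ a0 (seq_bounded_shift_sub c hb).
have a1 : iter n (back_sub c) a @ \oo --> 0 by elim: (n) => // k IHk; exact: cvg0_back_sub.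
have := cvgD h (cvg_shift_sub_back_sub c a1 hb); rewrite addr0; set F := (F in F @ _ --> _) => hF.
rewrite (_ : (fun N => _) = F); first exact: hF.
by apply/funext => N; rewrite /F /= -iterSr /= addrA subrK.
Qed.

End Sequences.

(** * An orthonormal basis of the model space *)

Definition seq_dot (R : realType) (a b : nat -> R[i]) : R[i] :=
  limn (series (fun n => a n * (b n)^*)).

Definition delta (R : realType) (k : nat) : nat -> R[i] := fun n => (n == k)%:R.

(* The Takenaka-Malmquist basis [s * moebius c z ^+ k / (1 - c^* z)]. *)
Fixpoint tm_basis (R : realType) (c : R[i]) (k : nat) : nat -> R[i] :=
  if k is k'.+1 then shift_sub c (div_den c (tm_basis c k'))
  else div_den c (sqrtC (1 - `|c| ^+ 2) *: delta R 0).

(* The dot product of [seq_back (tm_basis c i)] and [tm_basis c j], computed by the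
   recursion on [i] that is lemma [seq_back_tm_basisS]. *)
Fixpoint shift_coef (R : realType) (c : R[i]) (i j : nat) : R[i] :=
  if i is i'.+1 then (i' == j)%:R - c * shift_coef c i' j + c^* * (i == j)%:R
  else c^* * (0 == j)%N%:R.

Section InnerProduct.
Variable R : realType.
Implicit Types (a b : nat -> R[i]) (c : R[i]).

Lemma seq_bounded_conj b : seq_bounded b -> seq_bounded (fun n => (b n)^*).
Proof. by move=> [M M0 hM]; exists M => // n; rewrite norm_conjC. Qed.

Lemma seq_dot_cvg a b : abs_summable a -> abs_summable b ->
  series (fun n => a n * (b n)^*) @ \oo --> seq_dot a b.
Proof.
by move=> ha hb; apply: abs_summable_cvg; apply: abs_summableM => //; apply: seq_bounded_conj;
  exact: abs_summable_seq_bounded.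
Qed.

Lemma seq_dot_lim a b l :
  (fun N => \sum_(0 <= j < N) a j * (b j)^*) @ \oo --> l -> seq_dot a b = l.
Proof. exact: cvg_lim. Qed.

Lemma abs_summableB a b : abs_summable a -> abs_summable b -> abs_summable (a - b).
Proof. by move=> ha hb; rewrite -scaleN1r; apply: abs_summableD => //; exact: abs_summableZ. Qed.

Lemma seq_dotDl a a' b : abs_summable a -> abs_summable a' -> abs_summable b ->
  seq_dot (a + a') b = seq_dot a b + seq_dot a' b.
Proof.
move=> ha ha' hb; apply: seq_dot_lim.
rewrite (_ : (fun N => _) = (fun N => series (fun n => a n * (b n)^*) N + series (fun n => a' n
  * (b n)^*) N)).
  by apply: cvgD; exact: seq_dot_cvg.
by apply/funext => N; rewrite /series /= -big_split; apply: eq_bigr => i _; rewrite mulrDl.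
Qed.

Lemma seq_dotZl (k : R[i]) a b : abs_summable a -> abs_summable b ->
  seq_dot (k *: a) b = k * seq_dot a b.
Proof.
move=> ha hb; apply: seq_dot_lim.
rewrite (_ : (fun N => _) = (fun N => k * series (fun n => a n * (b n)^*) N)).
  by apply: cvgM; [exact: cvg_cst|exact: seq_dot_cvg].
by apply/funext => N; rewrite /series /= mulr_sumr; apply: eq_bigr => i _; rewrite mulrA.
Qed.

Lemma seq_dotC a b : abs_summable a -> abs_summable b -> seq_dot b a = (seq_dot a b)^*.
Proof.
move=> ha hb; apply: seq_dot_lim.
rewrite (_ : (fun N => _) = (fun N => (series (fun n => a n * (b n)^*) N)^*)).
  exact: cvg_conj (seq_dot_cvg ha hb).
apply/funext => N; rewrite /series /= raddf_sum; apply: eq_bigr => i _.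
by rewrite /= conjME conjCK mulrC.
Qed.

Lemma seq_dotBl a a' b : abs_summable a -> abs_summable a' -> abs_summable b ->
  seq_dot (a - a') b = seq_dot a b - seq_dot a' b.
Proof.
move=> ha ha' hb; rewrite -scaleN1r seq_dotDl ?seq_dotZl ?mulN1r //; exact: abs_summableZ.
Qed.

Lemma seq_dotBr a b b' : abs_summable a -> abs_summable b -> abs_summable b' ->
  seq_dot a (b - b') = seq_dot a b - seq_dot a b'.
Proof.
move=> ha hb hb'; have hB := abs_summableB hb hb'.
by rewrite seq_dotC // seq_dotBl // conjDE conjNE -!seq_dotC.
Qed.

Lemma seq_dotZr (k : R[i]) a b : abs_summable a -> abs_summable b ->
  seq_dot a (k *: b) = k^* * seq_dot a b.
Proof.
by move=> ha hb; rewrite seq_dotC ?seq_dotZl ?conjME -?seq_dotC //; exact: abs_summableZ.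
Qed.

Lemma abs_summable_0 : abs_summable (0 : nat -> R[i]).
Proof. by exists 0 => N; rewrite big1 // => i _; rewrite normr0. Qed.

Lemma abs_summable_sum n (F : 'I_n -> nat -> R[i]) : (forall i, abs_summable (F i)) ->
  abs_summable (\sum_i F i).
Proof. by move=> hF; elim/big_ind : _ => // [|a b ha hb];
  [exact: abs_summable_0|exact: abs_summableD]. Qed.

Lemma seq_dot0l b : abs_summable b -> seq_dot 0 b = 0.
Proof. by move=> hb; rewrite -(scale0r (0 : nat -> R[i])) seq_dotZl ?mul0r //;
  exact: abs_summable_0. Qed.

Lemma seq_dot_suml n (F : 'I_n -> nat -> R[i]) b : (forall i, abs_summable (F i)) ->
  abs_summable b ->
  seq_dot (\sum_i F i) b = \sum_i seq_dot (F i) b.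
Proof.
move=> hF hb; suff [] : abs_summable (\sum_i F i) /\ seq_dot (\sum_i F i) b = \sum_i seq_dot (F
  i) b by [].
elim/big_ind2 : _ => [|a x a' x' [h1 h2] [h3 h4]|i _].
- by split; [exact: abs_summable_0|rewrite seq_dot0l].
- by split; [exact: abs_summableD|rewrite seq_dotDl // h2 h4].
- by split.
Qed.

Lemma seq_dot_sumr n (F : 'I_n -> nat -> R[i]) a : (forall i, abs_summable (F i)) ->
  abs_summable a ->
  seq_dot a (\sum_i F i) = \sum_i seq_dot a (F i).
Proof.
move=> hF ha; rewrite seq_dotC ?seq_dot_suml //; last exact: abs_summable_sum.
by rewrite raddf_sum; apply: eq_bigr => i _; rewrite /= -seq_dotC.
Qed.

Lemma abs_summable_delta k : abs_summable (delta R k).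
Proof.
exists 1 => N; rewrite (eq_bigr (fun i : 'I_N => (i == k :> nat)%:R)); last first.
  by move=> i _; rewrite /delta normr_nat.
have [kN|kN] := ltnP k N.
  rewrite (bigD1 (Ordinal kN)) //= eqxx big1 ?addr0 // => i; rewrite -val_eqE /=.
  by move/negPf ->.
by rewrite big1 ?ler01 // => i _; rewrite ltn_eqF // (leq_trans (ltn_ord i)).
Qed.

Lemma seq_dot_delta k a : abs_summable a -> seq_dot (delta R k) a = (a k)^*.
Proof.
move=> ha; apply: seq_dot_lim; apply: cvg_near_cst; exists k.+1 => // N /= kN.
rewrite (big_cat_nat (n := k)) ?(ltnW kN) //= big_nat big1 ?add0r; last first.
  by move=> i /andP[_ ik]; rewrite /delta ltn_eqF // mul0r.
rewrite big_ltn // /delta eqxx mul1r big_nat big1 ?addr0 // => i /andP[ik _].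
by rewrite gtn_eqF // mul0r.
Qed.

Lemma cvg_seq_bounded_abs_summable a b : abs_summable a -> seq_bounded b ->
  cvgn (series (fun n => a n * (b n)^*)).
Proof. by move=> ha hb; apply: abs_summable_cvg; apply: abs_summableM => //;
  exact: seq_bounded_conj. Qed.

Lemma abs_summable_cvg0 a : abs_summable a -> a @ \oo --> (0 : R[i]).
Proof. by move=> /abs_summable_cvg; exact: cvg_series_cvg_0. Qed.

Lemma seq_dot_shift_sub c a b : abs_summable a -> abs_summable b ->
  seq_dot a (shift_sub c b) = seq_dot (back_sub c a) b.
Proof.
move=> ha hb; apply/eqP; rewrite -subr_eq0; apply/eqP.
have h1 := cvg_shift_sub_back_sub c (abs_summable_cvg0 ha) (abs_summable_seq_bounded hb).
transitivity (limn (fun N => series (fun n => a n * (shift_sub c b n)^*) N -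
    series (fun n => back_sub c a n * (b n)^*) N)); last exact: cvg_lim h1.
symmetry; apply: cvg_lim; first exact: norm_hausdorff.
by apply: cvgB; [exact: (seq_dot_cvg ha (abs_summable_shift_sub c hb))|exact:
  (seq_dot_cvg (abs_summable_back_sub c ha) hb)].
Qed.

Lemma seq_dot_seq_shift a b : abs_summable a -> abs_summable b ->
  seq_dot a (seq_shift b) = seq_dot (seq_back a) b.
Proof.
move=> ha hb; have := seq_dot_shift_sub 0 ha hb;
  rewrite /shift_sub /back_sub conj0E !scale0r !subr0.
by [].
Qed.

Lemma seq_dot_seq_shift_seq_shift a b : abs_summable a -> abs_summable b ->
  seq_dot (seq_shift a) (seq_shift b) = seq_dot a b.
Proof. by move=> ha hb; rewrite seq_dot_seq_shift //; exact: abs_summable_seq_shift. Qed.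

Lemma seq_dot_ge0 a : abs_summable a -> 0 <= seq_dot a a.
Proof.
move=> ha; have h := seq_dot_cvg ha ha.
suff -> : seq_dot a a = `|seq_dot a a| by [].
apply: seq_dot_lim; rewrite (_ : (fun N => _) = (fun N => `|series (fun n => a n * (a n)^*) N|)).
  by apply: cvg_norm; exact: h.
apply/funext => N; rewrite ger0_norm // /series /=.
by rewrite sumr_ge0 // => i _; rewrite -normCK exprn_ge0.
Qed.

Variable c : R[i].
Hypothesis c1 : `|c| < 1.

Notation E := (tm_basis c).

Lemma abs_summable_tm_basis k : abs_summable (E k).
Proof.
elim: k => [|k IHk] /=; first by apply: abs_summable_div_den => //; apply: abs_summableZ;
  exact: abs_summable_delta.
by apply: abs_summable_shift_sub; exact: abs_summable_div_den.
Qed.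

(** Multiplication by [moebius c] is isometric: written with [div_den c a] and [div_den c b], both
    sides have the same expansion because the shift is isometric. *)
Lemma seq_dot_phi a b : abs_summable a -> abs_summable b ->
  seq_dot (shift_sub c (div_den c a)) (shift_sub c (div_den c b)) = seq_dot a b.
Proof.
move=> /(abs_summable_div_den c1) ha /(abs_summable_div_den c1) hb;
  rewrite -{2}(div_denK c a) -{2}(div_denK c b) /shift_sub.
set u := div_den c a in ha *; set v := div_den c b in hb *.
have hu := abs_summable_seq_shift ha; have hv := abs_summable_seq_shift hb.
rewrite !(seq_dotBl, seq_dotBr, seq_dotZl, seq_dotZr) ?seq_dot_seq_shift_seq_shift ?conjCK;
  first ring.
all: by repeat first [assumption | apply: abs_summableB | apply: abs_summableZ].
Qed.

(** [E 0] is the normalized Szegő kernel at [c], an eigenvector of the backward shift. *)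
Lemma back_sub_tm_basis0 : back_sub c (E 0) = 0.
Proof.
rewrite back_sub_div_den; apply/funext => n; rewrite /seq_back /= /delta /=.
exact: mulr0.
Qed.

Lemma back_sub_tm_basisS k : back_sub c (E k.+1) = (1 - `|c| ^+ 2) *: E k - c *: back_sub c (E k).
Proof.
apply/funext => n; set v := div_den c (E k).
have h1 : seq_back (E k) n = v n.+1 - c^* * v n by rewrite -(back_sub_div_den c (E k)).
have h2 : E k n = v n - c^* * seq_shift v n by rewrite -{1}(div_denK c (E k)).
transitivity ((1 - `|c| ^+ 2) * E k n - c * (seq_back (E k) n - c^* * E k n)); last by [].
transitivity (shift_sub c v n.+1 - c^* * shift_sub c v n) => //.
by rewrite h1 h2 !shift_subE /= normCK; ring.
Qed.

(** The relation [(1 - c^* z) E_(k+1) = (z - c) E_k], shifted back once. *)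
Lemma seq_back_tm_basisS k : seq_back (E k.+1) = E k - c *: seq_back (E k) + c^* *: E k.+1.
Proof.
apply/funext => n.
have h : seq_back (E k.+1) n - c^* * E k.+1 n =
    (1 - `|c| ^+ 2) * E k n - c * (seq_back (E k) n - c^* * E k n).
  by have /(congr1 (fun u => u n)) := back_sub_tm_basisS k.
transitivity (E k n - c * seq_back (E k) n + c^* * E k.+1 n); last by [].
by apply/(subIr (c^* * E k.+1 n)); rewrite /= h normCK; ring.
Qed.

Lemma c2_gt0 : 0 < 1 - `|c| ^+ 2.
Proof. by rewrite subr_gt0 exprn_ilt1. Qed.

(** No series is summed: [E_0 = s + c^* z E_0] and the eigenvector equation give
    [x = 1 - |c|^2 + |c|^2 x] for the squared norm [x]. *)
Lemma seq_dot_tm_basis00 : seq_dot (E 0) (E 0) = 1.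
Proof.
have s0 := c2_gt0; set s := sqrtC (1 - `|c| ^+ 2).
have hE := abs_summable_tm_basis 0; have hs := abs_summable_seq_shift hE;
  have hd := abs_summable_delta 0.
have e : E 0 = s *: delta R 0 + c^* *: seq_shift (E 0) by rewrite -{1}(div_denK c (s *:
  delta R 0)) subrK.
have e0 : E 0 0%N = s.
  by rewrite /= addr0 -/s; exact: mulr1.
have h1 : seq_dot (E 0) (E 0) = s * s^* + c^* * seq_dot (seq_shift (E 0)) (E 0).
  by rewrite {1}e seq_dotDl ?seq_dotZl ?seq_dot_delta ?e0 //; exact: abs_summableZ.
have h2 : seq_dot (seq_shift (E 0)) (E 0) = c * seq_dot (E 0) (E 0).
  rewrite seq_dotC // seq_dot_seq_shift // (_ : seq_back (E 0) = c^* *: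
    E 0) ?seq_dotZl // ?conjME ?conjCK -?seq_dotC //.
  by apply/eqP; rewrite -subr_eq0; apply/eqP; exact: back_sub_tm_basis0.
have h3 : s * s^* = 1 - `|c| ^+ 2.
  by rewrite -normCK ger0_norm ?sqrtCK // sqrtC_ge0 ltW.
rewrite h2 h3 in h1; apply: (mulfI (negbT (gt_eqF s0))).
by rewrite mulrBl mul1r {1}h1 normCK mulr1; ring.
Qed.

(** The isometry lowers both indices together. Once the smaller one is [0], adjointness moves a
    factor [z - c] onto [E 0], which [back_sub c] annihilates. *)
Lemma seq_dot_tm_basis i j : seq_dot (E i) (E j) = (i == j)%:R.
Proof.
wlog ij : i j / (i <= j)%N.
  move=> h; have [|/ltnW] := leqP i j; first exact: h.
  move=> ji; rewrite seq_dotC; [|exact: abs_summable_tm_basis|exact: abs_summable_tm_basis].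
  by rewrite h // conjC_nat eq_sym.
elim: j i ij => [|j IHj] [|i] //; first by rewrite seq_dot_tm_basis00.
  move=> _; rewrite [E j.+1]/= seq_dot_shift_sub ?back_sub_tm_basis0 ?seq_dot0l //.
  - by apply: abs_summable_div_den => //; exact: abs_summable_tm_basis.
  - exact: abs_summable_tm_basis.
  - by apply: abs_summable_div_den => //; exact: abs_summable_tm_basis.
by move=> ij; rewrite /= seq_dot_phi ?IHj //; exact: abs_summable_tm_basis.
Qed.

Lemma seq_dot_seq_back_tm_basis i j : seq_dot (seq_back (E i)) (E j) = shift_coef c i j.
Proof.
have hE := abs_summable_tm_basis.
elim: i => [|i IHi].
  rewrite (_ : seq_back (E 0) = c^* *: E 0) ?seq_dotZl ?seq_dot_tm_basis //.
  by apply/eqP; rewrite -subr_eq0; apply/eqP; exact: back_sub_tm_basis0.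
rewrite seq_back_tm_basisS seq_dotDl ?seq_dotBl ?seq_dotZl ?seq_dot_tm_basis ?IHi //.
all: by repeat first [exact: hE | apply: abs_summable_seq_back | apply: abs_summableZ | apply:
  abs_summableB].
Qed.

Lemma iter_back_subB n (k : R[i]) a b :
  iter n (back_sub c) (a - k *: b) = iter n (back_sub c) a - k *: iter n (back_sub c) b.
Proof.
elim: n a b => // n IHn a b; rewrite !iterSr -IHn; congr (iter _ _ _).
apply/funext => j; transitivity ((a j.+1 - k * b j.+1) - c^* * (a j - k * b j)) => //.
transitivity ((a j.+1 - c^* * a j) - k * (b j.+1 - c^* * b j)) => //; ring.
Qed.

Lemma back_sub0 : back_sub c 0 = 0.
Proof. by apply/funext => m; rewrite back_subE mulr0 subr0. Qed.

Lemma iter_back_sub0 n : iter n (back_sub c) 0 = 0.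
Proof. by elim: n => //= n ->; exact: back_sub0. Qed.

Lemma iter_back_subZ n (k : R[i]) b : iter n (back_sub c) (k *: b) = k *: iter n (back_sub c) b.
Proof.
have := iter_back_subB n (- k) 0 b.
by rewrite !sub0r iter_back_sub0 sub0r !scaleNr !opprK.
Qed.

Lemma iter_back_subD n a b : iter n (back_sub c) (a + b) = iter n (back_sub c) a + iter n
  (back_sub c) b.
Proof. by have := iter_back_subB n (-1) a b; rewrite !scaleNr !opprK !scale1r. Qed.

(** The two claims are proved together: the leading term at [k.+1] is clean only because the next
    iterate at [k] vanishes. *)
Lemma iter_back_sub_tm_basis k :
  iter k (back_sub c) (E k) = (1 - `|c| ^+ 2) ^+ k *: E 0 /\ iter k.+1 (back_sub c) (E k) = 0.
Proof.
elim: k => [|k [h1 h2]]; first by rewrite expr0 scale1r /= back_sub_tm_basis0.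
split.
  by rewrite iterSr back_sub_tm_basisS iter_back_subB iter_back_subZ h1 -iterSr h2 scaler0
    subr0 scalerA -exprS.
by rewrite iterSr back_sub_tm_basisS iter_back_subB iter_back_subZ h2 -iterSr iterS h2 scaler0
  back_sub0 scaler0 subr0.
Qed.

Lemma iter_back_sub_tm_basis_eq0 n k : (k < n)%N -> iter n (back_sub c) (E k) = 0.
Proof.
by move=> kn; rewrite -(subnK kn) iterD (iter_back_sub_tm_basis k).2 iter_back_sub0.
Qed.

Lemma iter_back_sub_comb n m (y : 'I_n -> R[i]) : (n <= m)%N ->
  iter m (back_sub c) (\sum_(k < n) y k *: E k) = 0.
Proof.
move=> nm; elim/big_ind : _ => [|a b ha hb|k _]; first exact: iter_back_sub0.
  by rewrite iter_back_subD ha hb addr0.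
by rewrite iter_back_subZ iter_back_sub_tm_basis_eq0 ?scaler0 // (leq_trans (ltn_ord k)).
Qed.

Lemma back_sub_ker a : back_sub c a = 0 -> a = (a 0%N / sqrtC (1 - `|c| ^+ 2)) *: E 0.
Proof.
move=> ha; have s0 : sqrtC (1 - `|c| ^+ 2) != 0 by rewrite sqrtC_eq0 gt_eqF // c2_gt0.
apply/funext => n; transitivity (a 0%N / sqrtC (1 - `|c| ^+ 2) * E 0 n); last by [].
have rec b : back_sub c b = 0 -> forall m, b m.+1 = c^* * b m.
  move=> hb m; have := back_subE c b m; rewrite hb => /esym/eqP.
  by rewrite subr_eq0 => /eqP.
elim: n => [|n IHn]; last by rewrite (rec _ ha) (rec _ back_sub_tm_basis0) IHn mulrCA.
have -> : E 0 0%N = sqrtC (1 - `|c| ^+ 2) by rewrite /= addr0; exact: mulr1.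
by rewrite divfK.
Qed.

(** The [n]-th iterate of [a] lies in the kernel of [back_sub c], which is spanned by [E 0];
    subtracting the multiple of [E n] with the same [n]-th iterate lowers the order. *)
Lemma tm_basis_span n a : iter n (back_sub c) a = 0 -> exists y : 'I_n ->
  R[i], a = \sum_(k < n) y k *: E k.
Proof.
elim: n a => [|n IHn] a ha; first by exists (fun=> 0); rewrite big_ord0.
have := back_sub_ker ha; set t := _ / _ => ht.
have d0 : (1 - `|c| ^+ 2) ^+ n != 0 by rewrite expf_neq0 // gt_eqF // c2_gt0.
have [|y hy] := IHn (a - (t / (1 - `|c| ^+ 2) ^+ n) *: E n).
  by rewrite iter_back_subB (iter_back_sub_tm_basis n).1 scalerA divfK // -ht subrr.
exists (fun i => if insub (i : nat) is Some j then y j else t / (1 - `|c| ^+ 2) ^+ n).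
rewrite big_ord_recr /= insubF ?ltnn // -[a in LHS](subrK ((t / (1 - `|c| ^+ 2) ^+ n) *: E n)) hy.
by congr (_ + _); apply: eq_bigr => i _; rewrite insubT //= => h; congr (y _ *: _); exact: val_inj.
Qed.

End InnerProduct.

(** * Power series on the disk and the model space *)

Section Taylor.
Variable R : realType.
Implicit Types (a b : nat -> R[i]) (f g : disk R -> R[i]) (c : R[i]).

Lemma cvg0_seq_bounded a : a @ \oo --> (0 : R[i]) -> seq_bounded a.
Proof.
move=> ha; have /cvg_seq_bounded : cvgn a by apply/cvg_ex; exists 0.
case=> M [Mr hM]; have M1 : M < `|M| + 1 by rewrite (le_lt_trans (real_ler_norm Mr)) // ltrDl.
by exists (`|M| + 1) => [|n]; [exact: addr_ge0|exact: hM].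
Qed.

Lemma sum_geom_le (s : R[i]) N : 0 <= s -> s <= 2^-1 -> \sum_(0 <= j < N) s ^+ j <= 2.
Proof.
move=> s0 s1; elim: N => [|N IHN]; first by rewrite big_nil.
rewrite big_nat_recl // expr0 (eq_bigr (fun j => s * s ^+ j)) => [|j _]; last by rewrite exprS.
rewrite -mulr_sumr -[leRHS](_ : 1 + 2^-1 * 2 = 2); last by rewrite mulVf // -mulr2n.
by rewrite lerD2l ler_pM // sumr_ge0 // => j _; rewrite exprn_ge0.
Qed.

(** At a small [t > 0] the terms after the first add up to at most [4 K t], so [|e 0|] is at most
    [t (4 K + 1)]. *)
Lemma power_series_coef0 (e : nat -> R[i]) (K : R[i]) :
  (forall n, `|e n| <= K * 2 ^+ n) ->
  (forall z, 0 < `|z| < 1 -> series (fun n => e n * z ^+ n) @ \oo --> (0 : R[i])) ->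
  e 0%N = 0.
Proof.
move=> hK hz; have K0 : 0 <= K by have := hK 0%N; rewrite expr0 mulr1; exact: le_trans.
have key (t : R[i]) : 0 < t -> t <= 4^-1 -> `|e 0%N| <= t * (4 * K + 1).
  move=> t0 t4.
  have t1 : 0 < `|t| < 1.
    by rewrite gtr0_norm // t0 (le_lt_trans t4) // invf_lt1 // ltr1n.
  have /cvgr0Pnorm_lt /(_ _ t0)[N _ hN] := hz t t1.
  have := hN N.+1 (leqnSn N); rewrite /series /= big_nat_recl //= expr0 mulr1.
  set S := \sum_(0 <= i < N) _ => hS.
  have hS2 : `|S| <= t * (4 * K).
    apply: le_trans (ler_norm_sum _ _ _) _.
    apply: (@le_trans _ _ (\sum_(0 <= i < N) (2 * K * t) * (2 * t) ^+ i)).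
      apply: ler_sum => i _; rewrite normrM normrX (gtr0_norm t0).
      apply: le_trans (ler_wpM2r _ (hK i.+1)) _; first by rewrite exprn_ge0 // ltW.
      by rewrite !exprS exprMn le_eqVlt; apply/orP; left; apply/eqP; ring.
    rewrite -mulr_sumr; apply: (@le_trans _ _ (2 * K * t * 2)).
      apply: ler_wpM2l; first by rewrite !mulr_ge0 // ltW.
      apply: sum_geom_le; first by rewrite mulr_ge0 // ltW.
      by rewrite -ler_pdivlMl // (le_trans t4) // -invfM -natrM.
    by rewrite le_eqVlt; apply/orP; left; apply/eqP; ring.
  rewrite mulrDr mulr1 -[e 0%N](addrK S); apply: le_trans (ler_normB _ _) _.
  by rewrite addrC lerD // ltW.
apply/eqP; rewrite -normr_le0; apply/negPn/negP => h.
have e0 : 0 < `|e 0%N| by rewrite lt_def normr_ge0 andbT; apply: contraNneq h => ->.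
have d0 : 0 < 4 * K + 1 + 4 * `|e 0%N| by rewrite ltr_wpDl ?mulr_gt0 // addr_ge0 ?mulr_ge0.
(* This [t] is at most [1 / 4] by construction and small enough to contradict the bound. *)
have := key (`|e 0%N| / (4 * K + 1 + 4 * `|e 0%N|)).
rewrite divr_gt0 // => /(_ isT); rewrite ler_pdivrMr // => h1.
have /h1 : `|e 0%N| <= 4^-1 * (4 * K + 1 + 4 * `|e 0%N|).
  by rewrite mulrDr mulKf // lerDr mulr_ge0 // addr_ge0 ?mulr_ge0.
rewrite mulrAC ler_pdivlMr // ler_pM2l // gerDl pmulr_rle0 // => h2.
by have := lt_le_trans e0 h2; rewrite ltxx.
Qed.

(** Convergence at [1 / 2] bounds the differences [d n] by [K 2^n]. They vanish one after the other,
    dividing by [z ^+ n] each time, which is why the preceding lemma leaves out [z = 0]. *)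
Lemma is_taylor_inj f a b : is_taylor f a -> is_taylor f b -> a = b.
Proof.
move=> ha hb; pose d := a - b.
have hd z : `|z| < 1 -> series (fun n => d n * z ^+ n) @ \oo --> (0 : R[i]).
  move=> z1; pose w : disk R := exist _ z z1.
  rewrite (_ : series _ = (fun N => series (fun n => a n * z ^+ n) N -
    series (fun n => b n * z ^+ n) N)).
    by rewrite -(subrr (f w)); apply: cvgB; [exact: (ha w)|exact: (hb w)].
  by apply/funext => N; rewrite /series /= -sumrB; apply: eq_bigr => i _; rewrite -mulrBl.
have [K K0 hK] : seq_bounded (fun n => d n * 2^-1 ^+ n).
  apply: cvg0_seq_bounded; apply: cvg_series_cvg_0; apply/cvg_ex; exists 0; apply: hd.
  by rewrite normfV normr_nat invf_lt1 // ltr1n.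
have {}hK n : `|d n| <= K * 2 ^+ n.
  have := hK n; rewrite normrM normrX normfV normr_nat exprVn.
  by rewrite ler_pdivrMr // exprn_gt0.
suff d0 n : d n = 0 by apply/funext => n; apply/eqP; rewrite -subr_eq0; apply/eqP; exact: d0.
elim/ltn_ind: n => n IHn.
apply: (@power_series_coef0 (fun m => d (m + n)%N) (K * 2 ^+ n)) => [m|z /andP[z0 z1]].
  by rewrite -mulrA -exprD addnC.
have zn : z ^+ n != 0 by rewrite expf_neq0 // -normr_gt0.
have h : (fun N => series (fun m => d m * z ^+ m) (N + n)%N / z ^+ n) @ \oo --> (0 : R[i]).
  rewrite -[X in _ --> X](mul0r (z ^+ n)^-1); apply: cvgM; last exact: cvg_cst.
  by have := hd z z1; rewrite -(cvg_shiftn n).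
rewrite (_ : series _ = (fun N => series (fun m => d m * z ^+ m) (N + n)%N / z ^+ n));
  first exact: h.
apply/funext => N; apply: (mulIf zn); rewrite divfK // /series /= mulr_suml.
rewrite [RHS](big_cat_nat (n := n)) ?leq_addl //= [X in _ = X + _]big_nat.
rewrite [X in _ = X + _]big1 ?add0r => [|i /andP[_ /IHn ->]]; last by rewrite mul0r.
by rewrite -[X in \sum_(X <= _ < _) d _ * _]add0n big_addn addnK; apply: eq_bigr => i _;
  rewrite exprD mulrA.
Qed.

Lemma taylorE f a : is_taylor f a -> taylor f = a.
Proof.
move=> ha; rewrite /taylor; case: xgetP => [b _ hb|/(_ a)] //.
exact: is_taylor_inj hb ha.
Qed.

Lemma hdotE f g a b : is_taylor f a -> is_taylor g b -> hdot f g = seq_dot a b.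
Proof. by move=> /taylorE ha /taylorE hb; rewrite /hdot ha hb. Qed.

Lemma disk_pow (z : disk R) : (fun N => val z ^+ N) @ \oo --> (0 : R[i]).
Proof.
have [r hr] := complex_realP _ (normr_real (val z)).
have r1 : `|r| < 1.
  by rewrite -ltcR -norm_real_complex -hr normr_id; exact: (valP z).
have h : (fun N => (r ^+ N)%:C%C) @ \oo --> 0%:C%C by apply: cvg_real_complex; exact: cvg_expr.
apply/cvgr0Pnorm_lt => e e0; move/cvgr0Pnorm_lt : h => /(_ _ e0).
apply: filterS => N; rewrite rmorphXn /= -hr !normrX normr_id.
by [].
Qed.

Lemma is_taylor_fun a : abs_summable a -> is_taylor (fun z => limn (series (fun n => a n * val
  z ^+ n))) a.
Proof.
move=> ha z; apply: abs_summable_cvg; apply: (abs_summableM ha); exists 1 => // n.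
by rewrite normrX exprn_ile1 // ltW //; exact: (valP z).
Qed.

Lemma is_taylorD f g a b : is_taylor f a -> is_taylor g b -> is_taylor (fun z => f z + g z) (a + b).
Proof.
move=> ha hb z; rewrite (_ : series _ = (fun N => series (fun n => a n * val z ^+ n) N + series
  (fun n => b n * val z ^+ n) N)).
  by apply: cvgD; [exact: ha|exact: hb].
by apply/funext => N; rewrite /series /= -big_split; apply: eq_bigr => i _; exact: mulrDl.
Qed.

Lemma is_taylorZ (k : R[i]) f a : is_taylor f a -> is_taylor (fun z => k * f z) (k *: a).
Proof.
move=> ha z; rewrite (_ : series _ = (fun N => k * series (fun n => a n * val z ^+ n) N)).
  by apply: cvgM; [exact: cvg_cst|exact: ha].
by apply/funext => N; rewrite /series /= mulr_sumr; apply: eq_bigr => i _; rewrite mulrA.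
Qed.

Lemma is_taylor_seq_shift f a : is_taylor f a -> is_taylor (fun z => val z * f z) (seq_shift a).
Proof.
move=> ha z; rewrite -cvg_shiftS.
rewrite (_ : [sequence _]_n = (fun N => val z * series (fun n => a n * val z ^+ n) N)).
  by apply: cvgM; [exact: cvg_cst|exact: ha].
apply/funext => N; rewrite /series /= big_nat_recl //= mul0r add0r mulr_sumr.
by apply: eq_bigr => i _; rewrite exprS mulrCA.
Qed.

Lemma is_taylor_ext f g a : f =1 g -> is_taylor f a -> is_taylor g a.
Proof. by move=> e h z; rewrite -e; exact: h. Qed.

Lemma is_taylor_shift_sub c f a : is_taylor f a ->
  is_taylor (fun z => (val z - c) * f z) (shift_sub c a).
Proof.
move=> ha; have := is_taylorD (is_taylor_seq_shift ha) (is_taylorZ (k := - c) ha).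
by rewrite scaleNr; apply: is_taylor_ext => z; rewrite mulrBl mulNr.
Qed.

Lemma is_taylor_qinv c f a : is_taylor f a ->
  is_taylor (fun z => (1 - c^* * val z) * f z) (a - c^* *: seq_shift a).
Proof.
move=> ha; have := is_taylorD ha (is_taylorZ (k := - c^*) (is_taylor_seq_shift ha)).
by rewrite scaleNr; apply: is_taylor_ext => z; rewrite mulrBl mul1r mulNr mulrA.
Qed.

Lemma disk_den c (z : disk R) : `|c| < 1 -> 1 - c^* * val z != 0.
Proof.
move=> c1; rewrite subr_eq0; apply: contraL (mulr_ilt1 (normr_ge0 c) (normr_ge0 (val z)) c1
  (valP z)).
by move=> /eqP h; rewrite -norm_conjC -normrM -h normr1 ltxx.
Qed.

Lemma is_taylor_div_den c f a : `|c| < 1 -> seq_bounded a -> is_taylor f a ->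
  is_taylor (fun z => f z / (1 - c^* * val z)) (div_den c a).
Proof.
move=> c1 /(seq_bounded_div_den c1)[M M0 hM] ha z; have nz := disk_den z c1.
(* The partial sums of the quotient are known exactly up to a boundary term, which tends to [0]
   because [div_den c a] is bounded and [|z| < 1]. *)
rewrite (_ : series _ = (fun N => (series (fun n => a n * val z ^+ n) N
   - c^* * (seq_shift (div_den c a) N * val z ^+ N)) / (1 - c^* * val z))).
  apply: cvgM; last exact: cvg_cst.
  rewrite -[X in _ --> X]subr0; apply: cvgB; first exact: ha.
  rewrite -[X in _ --> X](mulr0 c^*); apply: cvgM; first exact: cvg_cst.
  have M1 : 0 < M + 1 by rewrite ltr_wpDl.
  apply/cvgr0Pnorm_lt => e e0.
  have /cvgr0Pnorm_lt /(_ _ (divr_gt0 e0 M1)) := disk_pow z.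
  apply: filterS => N; rewrite ltr_pdivlMr // mulrC normrM; apply: le_lt_trans.
  apply: ler_wpM2r => //; apply: (@le_trans _ _ M); last by rewrite lerDl.
  by case: N => [|N] //=; rewrite normr0.
apply/funext => N; apply: (mulIf nz); rewrite divfK // /series /=.
elim: N => [|N IHN]; first by rewrite !big_nil /=; ring.
rewrite !big_nat_recr //= mulrDl IHN.
have h : a N = div_den c a N - c^* * seq_shift (div_den c a) N by rewrite -{1}(div_denK c a).
by rewrite h exprS; ring.
Qed.

Lemma is_taylor_delta k : is_taylor (fun z : disk R => val z ^+ k) (delta R k).
Proof.
move=> z; apply: cvg_near_cst; exists k.+1 => // N /= kN; rewrite /series /=.
rewrite (big_cat_nat (n := k)) ?(ltnW kN) //= big_nat big1 ?add0r; last first.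
  by move=> i /andP[_ ik]; rewrite /delta ltn_eqF // mul0r.
rewrite big_ltn // /delta eqxx mul1r big_nat big1 ?addr0 // => i /andP[ik _].
by rewrite gtn_eqF // mul0r.
Qed.

Lemma hardy_cvg0 f a : hardy f -> is_taylor f a -> a @ \oo --> (0 : R[i]).
Proof.
move=> [b [hb cb]] ha; rewrite (is_taylor_inj ha hb).
have /cvgr0Pnorm_lt h := cvg_series_cvg_0 cb.
apply/cvgr0Pnorm_lt => e e0; have := h _ (exprn_gt0 2 e0).
apply: filterS => N; rewrite normrX normr_id => h2.
by rewrite -(ltr_pXn2r (n := 2)) // nnegrE ?ltW.
Qed.

Lemma abs_summable_hardy f a : abs_summable a -> is_taylor f a -> hardy f.
Proof.
move=> ha hf; exists a; split=> //.
rewrite (_ : (fun n => _) = (fun n => a n * (a n)^*)); last by apply/funext => n; rewrite normCK.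
by apply: cvg_seq_bounded_abs_summable => //; exact: abs_summable_seq_bounded.
Qed.

End Taylor.

(** The inner product of [z f] and [f], for [f] with coordinates [y] in the basis [tm_basis c]. The
    conjugate appears because [shift_coef] describes the adjoint. *)
Definition qform (R : realType) (c : R[i]) n (y : 'I_n -> R[i]) : R[i] :=
  \sum_(i < n) \sum_(j < n) y j * (y i)^* * (shift_coef c i j)^*.

Definition sqnorm (R : realType) n (y : 'I_n -> R[i]) : R[i] := \sum_(i < n) `|y i| ^+ 2.

Section ModelSpace.
Variables (R : realType) (Theta : finite_blaschke R) (l c : R[i]) (n : nat).
Hypotheses (l_norm : `|l| = 1) (c1 : `|c| < 1).
Hypothesis ThetaE : forall z, `|z| < 1 -> Theta z = l * moebius c z ^+ n.
Implicit Types (a b : nat -> R[i]) (f g : disk R -> R[i]).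

Let l_neq0 : l != 0. Proof. by rewrite -normr_eq0 l_norm oner_eq0. Qed.

(* The model space is the kernel of the [n]-th power of [S^* - c^*]. *)
Lemma model_space_iter f a :
  is_taylor f a -> model_space Theta f -> iter n (back_sub c) a = 0.
Proof.
move=> ha [hf orth]; have a0 := hardy_cvg0 hf ha.
apply/funext => k.
(* The test function [g] is chosen so that [Theta g] is the polynomial [(z - c)^n z^k]; pairing with
   it reads off the [k]-th coefficient of [iter n (back_sub c) a]. *)
pose q := l^-1 *: iter n (fun b => b - c^* *: seq_shift b) (delta R k).
pose g : disk R -> R[i] := fun z => l^-1 * ((1 - c^* * val z) ^+ n * val z ^+ k).
have hq : is_taylor g q.
  apply: is_taylorZ; elim: (n) => [|m IHm] /=.
    by apply: is_taylor_ext (@is_taylor_delta R k) => z; rewrite expr0 mul1r.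
  by apply: is_taylor_ext (is_taylor_qinv (c := c) IHm) => z; rewrite exprS mulrA.
have lq : abs_summable q.
  apply: abs_summableZ; elim: (n) => [|m IHm] /=; first exact: abs_summable_delta.
  by apply: abs_summableB => //; apply: abs_summableZ; exact: abs_summable_seq_shift.
have hT : is_taylor (fmul Theta g) (iter n (shift_sub c) (delta R k)).
  have h m : is_taylor (fun z : disk R => (val z -
    c) ^+ m * val z ^+ k) (iter m (shift_sub c) (delta R k)).
    elim: m => [|m IHm] /=.
      by apply: is_taylor_ext (@is_taylor_delta R k) => z; rewrite expr0 mul1r.
    by apply: is_taylor_ext (is_taylor_shift_sub (c := c) IHm) => z; rewrite exprS mulrA.
  apply: is_taylor_ext (h n) => z; rewrite /fmul /g (ThetaE (valP z)) /moebius.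
  have nz : (1 - c^* * val z) ^+ n != 0 by rewrite expf_neq0 // disk_den.
  by rewrite expr_div_n; field; rewrite l_neq0.
have h0 : hdot f (fmul Theta g) = 0.
  by apply: orth; exists g; [exact: (abs_summable_hardy lq hq)|reflexivity].
rewrite (hdotE ha hT) in h0.
have hT1 : abs_summable (iter n (shift_sub c) (delta R k)).
  by elim: (n) => [|m IHm] /=; [exact: abs_summable_delta|exact: abs_summable_shift_sub].
have ba : seq_bounded a := cvg0_seq_bounded a0.
(* [hdot] is a [limn], which says nothing without convergence; here it converges because the second
   factor has the coefficients of a polynomial. *)
have cv : series (fun j => a j * (iter n (shift_sub c) (delta R k) j)^*) @ \oo --> (0 : R[i]).
  rewrite -h0; apply: abs_summable_cvg.
  rewrite (_ : (fun j => _) = (fun j => (iter n (shift_sub c) (delta R k) j)^* * a j)); last first.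
    by apply/funext => j; rewrite mulrC.
  apply: abs_summableM => //; case: hT1 => M hM; exists M => N; apply: le_trans (hM N).
  by apply: ler_sum => j _; rewrite norm_conjC.
have cv2 := cvg_iter_shift_sub_back_sub c n a0 (abs_summable_seq_bounded (abs_summable_delta R k)).
have cv3 : (fun N => \sum_(0 <= j < N) iter n (back_sub c) a j * (delta R k j)^*) @ \oo --> (0
  : R[i]).
  rewrite -[X in _ --> X](subrr (0 : R[i])).
  rewrite (_ : (fun N => _) = (fun N => series (fun j => a j * (iter n (shift_sub c) (delta R
    k) j)^*) N -
    (\sum_(0 <= j < N) a j * (iter n (shift_sub c) (delta R k) j)^* -
     \sum_(0 <= j < N) iter n (back_sub c) a j * (delta R k j)^*))).
    by apply: cvgB; [exact: cv|exact: cv2].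
  by apply/funext => N; rewrite /series /= subKr.
have cv4 : (fun N => \sum_(0 <= j < N) iter n (back_sub c) a j * (delta R k j)^*) @ \oo -->
  iter n (back_sub c) a k.
  apply: cvg_near_cst; exists k.+1 => // N /= kN.
  rewrite (big_cat_nat (n := k)) ?(ltnW kN) //= big_nat big1 ?add0r; last first.
    by move=> i /andP[_ ik]; rewrite /delta ltn_eqF // conj0E mulr0.
  rewrite big_ltn // /delta eqxx conj1E mulr1 big_nat big1 ?addr0 // => i /andP[ik _].
  by rewrite gtn_eqF // conj0E mulr0.
have e1 := cvg_lim (@norm_hausdorff _ _) cv3.
have e2 := cvg_lim (@norm_hausdorff _ _) cv4.
by rewrite -e2 e1.
Qed.

(** [Theta g] is [(z - c)^n] times a function with bounded coefficients, and adjointness moves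
    [(z - c)^n] onto [f], where it gives [0]. *)
Lemma iter_model_space f a :
  is_taylor f a -> abs_summable a -> iter n (back_sub c) a = 0 -> model_space Theta f.
Proof.
move=> ha la Da; split; first exact: abs_summable_hardy la ha.
move=> _ [g hg <-]; have [b [hb _]] := hg.
have bb : seq_bounded b := cvg0_seq_bounded (hardy_cvg0 hg hb).
have bq m : seq_bounded (iter m (div_den c) b) by elim: m => // m IHm; exact: seq_bounded_div_den.
have hq m : is_taylor (fun z : disk R => g z / (1 - c^* * val z) ^+ m) (iter m (div_den c) b).
  elim: m => [|m IHm] /=; first by apply: is_taylor_ext hb => z; rewrite expr0 divr1.
  by apply: is_taylor_ext (is_taylor_div_den c1 (bq m) IHm) => z; rewrite exprS invfM mulrAC mulrA.
have hT : is_taylor (fmul Theta g) (iter n (shift_sub c) (l *: iter n (div_den c) b)).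
  have h m : is_taylor (fun z : disk R => (val z - c) ^+ m * (l * (g z / (1 - c^* * val z) ^+ n)))
      (iter m (shift_sub c) (l *: iter n (div_den c) b)).
    elim: m => [|m IHm] /=.
      by apply: is_taylor_ext (is_taylorZ (k := l) (hq n)) => z; rewrite expr0 mul1r.
    by apply: is_taylor_ext (is_taylor_shift_sub (c := c) IHm) => z; rewrite exprS mulrA.
  apply: is_taylor_ext (h n) => z; rewrite /fmul (ThetaE (valP z)) /moebius.
  by rewrite expr_div_n; ring.
rewrite (hdotE ha hT); apply: seq_dot_lim.
have := cvg_iter_shift_sub_back_sub c n (abs_summable_cvg0 la) (seq_boundedZ l (bq n)).
rewrite Da => h; rewrite (_ : (fun N => _) = (fun N => \sum_(0 <= j < N) a j * (iter n
  (shift_sub c) (l *: iter n (div_den c) b) j)^* -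
   \sum_(0 <= j < N) (0 : nat -> R[i]) j * ((l *: iter n (div_den c) b) j)^*)); first exact: h.
apply/funext => N; rewrite [X in _ - X]big1 ?subr0 // => j _; exact: mul0r.
Qed.

Local Notation E := (tm_basis c).
Local Notation comb y := (\sum_(k < n) y k *: E k).

Lemma model_spaceP f : model_space Theta f <-> exists y : 'I_n -> R[i], is_taylor f (comb y).
Proof.
split=> [hf|[y hy]].
  have [[a [ha _]] _] := hf.
  by have [y hy] := tm_basis_span c1 (model_space_iter ha hf); exists y; rewrite -hy.
apply: iter_model_space hy _ _; last exact: iter_back_sub_comb.
by apply: abs_summable_sum => i; apply: abs_summableZ; exact: abs_summable_tm_basis.
Qed.

Lemma abs_summable_comb (y : 'I_n -> R[i]) : abs_summable (comb y).
Proof. by apply: abs_summable_sum => i; apply: abs_summableZ; exact: abs_summable_tm_basis. Qed.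

Lemma seq_dot_comb a (y : 'I_n -> R[i]) : abs_summable a ->
  seq_dot a (comb y) = \sum_(i < n) (y i)^* * seq_dot a (E i).
Proof.
move=> ha; rewrite seq_dot_sumr => [||] //; last by move=> i; apply: abs_summableZ;
  exact: abs_summable_tm_basis.
by apply: eq_bigr => i _; rewrite seq_dotZr //; exact: abs_summable_tm_basis.
Qed.

Lemma seq_dot_combl a (y : 'I_n -> R[i]) : abs_summable a ->
  seq_dot (comb y) a = \sum_(i < n) y i * seq_dot (E i) a.
Proof.
move=> ha; rewrite seq_dot_suml => [||] //; last by move=> i; apply: abs_summableZ;
  exact: abs_summable_tm_basis.
by apply: eq_bigr => i _; rewrite seq_dotZl //; exact: abs_summable_tm_basis.
Qed.

Lemma seq_dot_comb_tm_basis (y : 'I_n -> R[i]) (k : 'I_n) : seq_dot (comb y) (E k) = y k.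
Proof.
rewrite seq_dot_combl; last exact: abs_summable_tm_basis.
rewrite (bigD1 k) //= seq_dot_tm_basis // eqxx mulr1 big1 ?addr0 // => i ik.
by rewrite seq_dot_tm_basis // -[(i == k :> nat)]/(i == k) (negPf ik) mulr0.
Qed.

Lemma seq_dot_comb_comb (y : 'I_n -> R[i]) : seq_dot (comb y) (comb y) = sqnorm y.
Proof.
rewrite seq_dot_comb; last exact: abs_summable_comb.
by apply: eq_bigr => i _; rewrite seq_dot_comb_tm_basis normCKC.
Qed.

Lemma seq_dot_seq_shift_comb (y : 'I_n -> R[i]) : seq_dot (seq_shift (comb y)) (comb y) = qform c y.
Proof.
have lc := abs_summable_comb y; rewrite seq_dot_comb; last exact: abs_summable_seq_shift.
apply: eq_bigr => i _; rewrite seq_dotC; [|exact: abs_summable_tm_basis|exact: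
  abs_summable_seq_shift].
rewrite seq_dot_seq_shift //; last exact: abs_summable_tm_basis.
rewrite seq_dot_comb; last by apply: abs_summable_seq_back; exact: abs_summable_tm_basis.
rewrite raddf_sum mulr_sumr; apply: eq_bigr => j _.
by rewrite /= seq_dot_seq_back_tm_basis // conjME conjCK mulrCA mulrA.
Qed.

(** [orth_proj] is a choice with a default. For any admissible [g], the difference of [z f] and [g]
    is orthogonal to [f], so [z f] and [g] pair equally with [f]; the default is excluded by the [g]
    whose coordinates are the inner products of [z f] with the basis. *)
Lemma compressed_shift_dot f (y : 'I_n -> R[i]) : is_taylor f (comb y) ->
  hdot (compressed_shift Theta f) f = qform c y.
Proof.
move=> hf; have hz : is_taylor (fmul id f) (seq_shift (comb y)) := is_taylor_seq_shift hf.
have lc := abs_summable_comb y; have ls := abs_summable_seq_shift lc.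
rewrite /compressed_shift /orth_proj; case: xgetP => [g _ [/[dup] gK /model_spaceP[w hw]] [_ ho]|].
  have hd : is_taylor (fmul id f \- g) (seq_shift (comb y) - comb w).
    by have := is_taylorD hz (is_taylorZ (k := -1) hw); rewrite scaleN1r;
       apply: is_taylor_ext => z; rewrite mulN1r.
  have := ho f; rewrite (hdotE hd hf) (hdotE hw hf) -seq_dot_seq_shift_comb.
  have fK : model_space Theta f by apply/model_spaceP; exists y.
  move=> /(_ fK); rewrite seq_dotBl //; last exact: abs_summable_comb.
  by move/subr0_eq.
pose w : 'I_n -> R[i] := fun k => seq_dot (seq_shift (comb y)) (E k).
have hw := is_taylor_fun (abs_summable_comb w); set g := (fun z => _) in hw.
move=> /(_ g); case; split; first by apply/model_spaceP; exists w.
have hd : is_taylor (fmul id f \- g) (seq_shift (comb y) - comb w).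
  by have := is_taylorD hz (is_taylorZ (k := -1) hw); rewrite scaleN1r;
     apply: is_taylor_ext => z; rewrite mulN1r.
have ld : abs_summable (seq_shift (comb y) - comb w) by apply: abs_summableB => //;
  exact: abs_summable_comb.
split; first exact: abs_summable_hardy ld hd.
move=> h /model_spaceP[v hv]; rewrite (hdotE hd hv) seq_dot_comb // big1 // => k _.
rewrite seq_dotBl //; [|exact: abs_summable_comb|exact: abs_summable_tm_basis].
by rewrite seq_dot_comb_tm_basis subrr mulr0.
Qed.

Lemma numerical_rangeE :
  numerical_range (model_space Theta) (compressed_shift Theta) =
  [set qform c y | y in [set y : 'I_n -> R[i] | sqnorm y = 1]].
Proof.
have nE f (y : 'I_n -> R[i]) : is_taylor f (comb y) -> hnorm f = 1 <-> sqnorm y = 1.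
  move=> hf; rewrite /hnorm (hdotE hf hf) seq_dot_comb_comb; split=> [|->]; last exact: sqrtC1.
  by move=> /(congr1 (fun x => x ^+ 2)); rewrite sqrtCK expr1n.
apply/seteqP; split=> z /=.
  move=> [f [/model_spaceP[y hy] hn] <-]; exists y; first by apply/(nE f).
  by rewrite (compressed_shift_dot hy).
move=> [y hy <-]; have hf := is_taylor_fun (abs_summable_comb y).
set f := (fun z => _) in hf; exists f; last exact: compressed_shift_dot.
by split; [apply/model_spaceP; exists y|apply/(nE f y)].
Qed.

(** Cauchy-Schwarz together with the isometry of the shift. It keeps the numerical range in the
    closed unit disk, where Blaschke products are continuous. *)
Lemma qform_norm_le1 (y : 'I_n -> R[i]) : sqnorm y = 1 -> `|qform c y| <= 1.
Proof.
rewrite -seq_dot_comb_comb -seq_dot_seq_shift_comb; set a := comb y => a1.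
have la : abs_summable a := abs_summable_comb y; have ls := abs_summable_seq_shift la;
  set z := seq_dot _ _.
have := @seq_dot_ge0 R (seq_shift a - z *: a);
  rewrite !(seq_dotBl, seq_dotBr, seq_dotZl, seq_dotZr) ?seq_dot_seq_shift_seq_shift ?a1 -/z //.
have -> : seq_dot a (seq_shift a) = z^* by rewrite seq_dotC.
rewrite mulr1 subrr mulr0 subr0 -normCKC => h.
rewrite -(ler_pXn2r (n := 2)) ?nnegrE // expr1n -subr_ge0; apply: h.
all: by repeat first [assumption | apply: abs_summableB | apply: abs_summableZ].
Qed.

End ModelSpace.

(** * Convexity and compactness of the numerical range *)

Definition form (R : realType) n (A : 'I_n -> 'I_n -> R[i]) (y w : 'I_n -> R[i]) : R[i] :=
  \sum_(i < n) \sum_(j < n) y j * (w i)^* * A i j.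

Definition num_range (R : realType) n (A : 'I_n -> 'I_n -> R[i]) : set R[i] :=
  [set form A y y | y in [set y : 'I_n -> R[i] | sqnorm y = 1]].

Section NumericalRange.
Variables (R : realType) (n : nat) (A : 'I_n -> 'I_n -> R[i]).
Implicit Types (y w v : 'I_n -> R[i]) (k z : R[i]).

Definition dotp y w : R[i] := \sum_(i < n) y i * (w i)^*.

Lemma form_lin k y w v :
  (form A (y + k *: w) v = form A y v + k * form A w v) *
  (form A v (y + k *: w) = form A v y + k^* * form A v w).
Proof.
split; rewrite /form mulr_sumr -big_split; apply: eq_bigr => i _;
  rewrite mulr_sumr -big_split; apply: eq_bigr => j _.
  transitivity ((y j + k * w j) * (v i)^* * A i j) => //=; ring.
transitivity (v j * (y i + k * w i)^* * A i j) => //=.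
by rewrite !conjE; ring.
Qed.

Lemma dotp_lin k y w v :
  (dotp (y + k *: w) v = dotp y v + k * dotp w v) *
  (dotp v (y + k *: w) = dotp v y + k^* * dotp v w).
Proof.
split; rewrite /dotp mulr_sumr -big_split; apply: eq_bigr => i _.
  transitivity ((y i + k * w i) * (v i)^*) => //=; ring.
transitivity (v i * (y i + k * w i)^*) => //=.
by rewrite !conjE; ring.
Qed.

Lemma dotpC y w : dotp w y = (dotp y w)^*.
Proof.
by rewrite /dotp raddf_sum; apply: eq_bigr => i _; rewrite /= conjME conjCK mulrC.
Qed.

Lemma sqnormE y : sqnorm y = dotp y y.
Proof. by apply: eq_bigr => i _; rewrite normCK. Qed.

Lemma sqnorm_ge0 y : 0 <= sqnorm y.
Proof. by rewrite sumr_ge0 // => i _; rewrite exprn_ge0. Qed.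

Lemma sqnorm_eq0 y : sqnorm y = 0 -> y = 0.
Proof.
move=> /eqP; rewrite psumr_eq0 => [/allP h|i _]; last by rewrite exprn_ge0.
apply/funext => i; have := h i (mem_index_enum i); rewrite /= expf_eq0 /= normr_eq0.
by move/eqP.
Qed.

Lemma sqnormZ k y : sqnorm (k *: y) = `|k| ^+ 2 * sqnorm y.
Proof. by rewrite /sqnorm mulr_sumr; apply: eq_bigr => i _; rewrite normrM exprMn. Qed.

Lemma formZ k y : form A (k *: y) (k *: y) = `|k| ^+ 2 * form A y y.
Proof.
rewrite /form mulr_sumr; apply: eq_bigr => i _; rewrite mulr_sumr; apply: eq_bigr => j _.
transitivity (k * y j * (k * y i)^* * A i j) => //.
by rewrite conjME normCK; ring.
Qed.

Lemma num_rangeI y z : sqnorm y != 0 -> form A y y = z * sqnorm y -> num_range A z.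
Proof.
move=> y0 hy; have s0 : 0 < sqnorm y by rewrite lt_def y0 sqnorm_ge0.
have hk : `|(sqrtC (sqnorm y))^-1| ^+ 2 = (sqnorm y)^-1.
  by rewrite normfV exprVn -normrX sqrtCK gtr0_norm.
exists ((sqrtC (sqnorm y))^-1 *: y) => /=; first by rewrite sqnormZ hk mulVf.
by rewrite formZ hk hy mulrC mulfK.
Qed.

(** The imaginary part of the sum is that of [u^* * (a - b^* )], so [u] is taken along [a - b^*]. *)
Lemma phase_real (a b : R[i]) : exists2 u : R[i], `|u| = 1 & u^* * a + u * b \is Num.real.
Proof.
have [h|h] := eqVneq (a - b^*) 0.
  exists 1; first exact: normr1.
  by rewrite conj1E !mul1r (subr0_eq h) CrealE !conjE conjCK addrC.
exists ((a - b^*) / `|a - b^*|); first by rewrite normrM normfV normr_id divff ?normr_eq0.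
have n0 : `|a - b^*| != 0 by rewrite normr_eq0.
have nJ : `|a - b^*|^* = `|a - b^*| by rewrite conj_Creal // normr_real.
set N := `|a - b^*| in n0 nJ *.
by rewrite CrealE !conjE !conjCK nJ; apply/eqP; field.
Qed.

(* The phase [u] makes the form real on the real span of [y] and [u w], where
   hitting the required value is a quadratic equation with roots of opposite signs. *)
Lemma num_range_convex p q (t : R) : num_range A p -> num_range A q -> 0 <= t <= 1 ->
  num_range A (q + t%:C%C * (p - q)).
Proof.
move=> [w w1 hp] [y y1 hq] /andP[t0 t1].
(* At [t = 1] the quadratic equation loses its leading coefficient [1 - t]. *)
have [->|tn1] := eqVneq t 1.
  by rewrite mul1r addrC subrK; exists w.
have [->|qp] := eqVneq p q; first by rewrite subrr mulr0 addr0; exists y.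
have d0 : p - q != 0 by rewrite subr_eq0.
(* Off-diagonal values of the form of [(A - q) / (p - q)], which is [0] at [y] and [1] at [w]; the
   value [t] is sought. *)
pose a := (form A y w - q * dotp y w) / (p - q).
pose b := (form A w y - q * dotp w y) / (p - q).
have [u u1 hu] := phase_real a b; have [kap hk] := complex_realP _ hu.
have hnu : u^* * dotp y w + u * dotp w y \is Num.real.
  by rewrite CrealE !conjE conjCK -!dotpC addrC.
have [nu hn] := complex_realP _ hnu.
pose be := kap - t * nu; pose D := be ^+ 2 + 4 * t * (1 - t).
have t1' : 0 < 1 - t by rewrite subr_gt0 lt_neqAle tn1.
have D0 : 0 <= D by rewrite addr_ge0 ?sqr_ge0 // !mulr_ge0 // ltW.
have [r hr] : exists r : R, r ^+ 2 + r * kap = t * (1 + r ^+ 2 + r * nu).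
  pose r := (- be + Num.sqrt D) / (2 * (1 - t)); exists r.
  have hs := sqr_sqrtr D0.
  have e2 : 2 * (1 - t) * r = - be + Num.sqrt D by rewrite /r mulrC divfK // mulf_neq0 // gt_eqF.
  have : (2 * (1 - t) * r + be) ^+ 2 = D by rewrite e2 addrAC addNr add0r.
  rewrite /D /be => h3.
  have {}h3 : 4 * (1 - t) * (r ^+ 2 + r * kap - t * (1 + r ^+ 2 + r * nu)) = 0.
    apply/eqP; rewrite -[X in _ == X](subrr ((kap - t * nu) ^+ 2 + 4 * t * (1 - t))).
    by rewrite -{1}h3; apply/eqP; ring.
  apply/subr0_eq; apply: (mulfI (_ : 4 * (1 - t) != 0)); last by rewrite h3 mulr0.
  by rewrite mulf_neq0 // gt_eqF.
have uu : u * u^* = 1 by rewrite -normCK u1 expr1n.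
pose rc := r%:C%C; have rcr : rc^* = rc by rewrite conj_Creal // complex_real.
pose v := y + (rc * u) *: w.
have hN : sqnorm v = 1 + rc ^+ 2 + rc * nu%:C%C.
  rewrite sqnormE /v !dotp_lin -!sqnormE w1 y1 -hn !conjE rcr.
  transitivity (1 + rc ^+ 2 * (u * u^*) + rc * (u^* * dotp y w + u * dotp w y)); first ring.
  by rewrite uu mulr1.
have hF : form A v v = q * sqnorm v + (p - q) * (rc ^+ 2 + rc * kap%:C%C).
  rewrite hN /v !form_lin hp hq -hn -hk /a /b !conjE rcr.
  transitivity (q + (rc ^+ 2 * p) * (u * u^*) + rc * (u^* * form A y w + u * form A w y));
    first ring.
  by rewrite uu mulr1; field.
have hr' : rc ^+ 2 + rc * kap%:C%C = t%:C%C * sqnorm v.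
  by rewrite hN; have := congr1 (real_complex R) hr; rewrite !(rmorphD, rmorphM, rmorphXn, rmorph1).
apply: (num_rangeI (y := v)); last by rewrite hF hr'; ring.
(* If [v] vanished, [y] would be a unimodular multiple of [w], and [p] would equal [q]. *)
apply/negP => /eqP v0; have := sqnorm_eq0 v0 => /eqP; rewrite addr_eq0 -scaleNr => /eqP hy.
have := sqnormZ (- (rc * u)) w; rewrite -hy y1 w1 mulr1 => hh.
by have := formZ (- (rc * u)) w; rewrite -hy -hh mul1r hp hq => hpq; rewrite hpq eqxx in qp.
Qed.

Lemma norm_normc (x : R[i]) : `|x| = (ComplexField.Normc.normc x)%:C%C.
Proof. by []. Qed.

Lemma normc_continuous (T : topologicalType) (h : T -> R[i]) (x : T) :
  {for x, continuous h} -> {for x, continuous (fun t => ComplexField.Normc.normc (h t))}.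
Proof.
move=> hc; apply/cvgrPdist_lt => e e0.
have e0' : 0 < e%:C%C :> R[i] by rewrite -[0]/(0%:C%C) ltcR.
move/cvgrPdist_lt : hc => /(_ _ e0'); apply: filterS => t.
rewrite -ltcR -norm_real_complex rmorphB /= -!norm_normc; apply: le_lt_trans.
exact: ler_dist_dist.
Qed.

Lemma continuous_addC (T : topologicalType) (f g : T -> R[i]) :
  continuous f -> continuous g -> continuous (fun x => f x + g x).
Proof. by move=> hf hg x; apply: cvgD; [exact: hf|exact: hg]. Qed.

Lemma continuous_mulC (T : topologicalType) (f g : T -> R[i]) :
  continuous f -> continuous g -> continuous (fun x => f x * g x).
Proof. by move=> hf hg x; apply: cvgM; [exact: hf|exact: hg]. Qed.

Lemma normc_continuousN (T : topologicalType) (h : T -> R[i]) (x : T) :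
  {for x, continuous h} -> {for x, continuous (fun t => - ComplexField.Normc.normc (h t))}.
Proof. by move=> hc; apply: cvgN; exact: normc_continuous. Qed.

Let vec (x : 'rV[R]_(n + n)) : 'I_n -> R[i] :=
  fun i => (x 0 (lshift n i))%:C%C + 'i%C * (x 0 (rshift n i))%:C%C.

Lemma continuous_vec i : continuous (fun x => vec x i).
Proof.
have hr : continuous (fun s : R => s%:C%C : R[i]).
  move=> s; apply/cvgrPdist_lt => -[e e']; rewrite ltcE /= => /andP[/eqP -> e0].
  have /cvgrPdist_lt /(_ _ e0) := @cvg_id _ (nbhs s).
  by apply: filterS => t; rewrite -rmorphB norm_real_complex ltcR.
have hc j : continuous (fun x : 'rV[R]_(n + n) => (x 0 j)%:C%C : R[i]).
  move=> x; apply: (@continuous_comp _ _ _ (fun x : 'rV[R]_(n + n) => x 0 j)); last exact: hr.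
  exact: coord_continuous.
apply: continuous_addC; first exact: hc.
by apply: continuous_mulC; [exact: cst_continuous|exact: hc].
Qed.

Lemma continuous_sum (T : topologicalType) (m : nat) (h : 'I_m -> T -> R[i]) :
  (forall i, continuous (h i)) -> continuous (fun x => \sum_i h i x).
Proof.
elim: m h => [|m IHm] h hc x.
  rewrite (_ : (fun x => _) = (fun=> 0)); first exact: cvg_cst.
  by apply/funext => t; rewrite big_ord0.
rewrite (_ : (fun x => _) = (fun x => h ord0 x + \sum_i h (lift ord0 i) x)).
  by apply: cvgD; [exact: hc|exact: IHm].
by apply/funext => t; rewrite big_ord_recl.
Qed.

Lemma continuous_conj (T : topologicalType) (h : T -> R[i]) :
  continuous h -> continuous (fun x => (h x)^*).
Proof.
move=> hc x; have /cvgrPdist_lt hx := hc x; apply/cvgrPdist_lt => e e0.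
by have := hx e e0; apply: filterS => t; rewrite -conjNE -conjDE norm_conjC.
Qed.

(** In real coordinates the unit sphere is a closed subset of a box with sides [[-1, 1]], hence
    compact. Continuity is asked on the range only, since a Blaschke product may have poles outside
    the closed disk. *)
Lemma num_range_max (g : R[i] -> R) : num_range A !=set0 ->
  (forall z, num_range A z -> {for z, continuous g}) ->
  exists2 z, num_range A z & forall z', num_range A z' -> g z' <= g z.
Proof.
move=> [z0 [y0 y01 _]] hg.
pose S : set 'rV[R]_(n + n) := [set x | sqnorm (vec x) = 1].
have vecP y : exists x, vec x = y.
  exists (row_mx (\row_i complex.Re (y i)) (\row_i complex.Im (y i))).
  by apply/funext => i; rewrite /vec row_mxEl row_mxEr !mxE -complexE.
have cform : continuous (fun x => form A (vec x) (vec x)).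
  apply: continuous_sum => i; apply: continuous_sum => j.
  apply: continuous_mulC; last exact: cst_continuous.
  apply: continuous_mulC; first exact: continuous_vec.
  exact: (continuous_conj (@continuous_vec i)).
have cnorm : continuous (fun x => sqnorm (vec x)).
  rewrite (_ : (fun x => _) = (fun x => \sum_i vec x i * (vec x i)^*)); last first.
    by apply/funext => x; rewrite sqnormE.
  apply: continuous_sum => i; apply: continuous_mulC; first exact: continuous_vec.
  exact: (continuous_conj (@continuous_vec i)).
have Sbox x : S x -> forall j, `[-1, 1]%classic (x 0 j).
  move=> Sx j; rewrite /= in_itv /= -ler_norml -(ler_pXn2r (n := 2)) ?nnegrE // expr1n.
  rewrite -normrX ger0_norm ?sqr_ge0 // -lecR rmorph1 -Sx.
  have key i : (x 0 (lshift n i) ^+ 2 + x 0 (rshift n i) ^+ 2)%:C%C <= sqnorm (vec x).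
    have -> : (x 0 (lshift n i) ^+ 2 + x 0 (rshift n i) ^+ 2)%:C%C = `|vec x i| ^+ 2.
      by rewrite -add_Re2_Im2 /vec; congr (_%:C%C); rewrite /= !(mul0r, mul1r, addr0, add0r, subr0).
    by rewrite /sqnorm (bigD1 i) //= lerDl sumr_ge0 // => k _; rewrite exprn_ge0.
  case: (split_ordP j) => i ->; apply: le_trans (key i); rewrite lecR.
    by rewrite lerDl sqr_ge0.
  by rewrite lerDr sqr_ge0.
have cS : compact S.
  apply: (@subclosed_compact _ _ [set x : 'rV[R]_(n + n) | forall j, `[-1, 1]%classic (x ord0 j)]).
  - rewrite (_ : S = (fun x => sqnorm (vec x)) @^-1` [set 1]) //.
    apply: preimage_closed; first by move=> x _; exact: cnorm.
    by apply: accessible_closed_set1; apply: hausdorff_accessible; exact: norm_hausdorff.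
  - by apply: (@rV_compact R (n + n) (fun=> `[-1, 1]%classic)) => j; exact: segment_compact.
  - by move=> x /Sbox.
have [x0 hx0] := vecP y0.
have S0 : S !=set0 by exists x0; rewrite /S /= hx0.
have cg : {within S, continuous (fun x => g (form A (vec x) (vec x)))}.
  apply: continuous_in_subspaceT => x /set_mem Sx.
  apply: (@continuous_comp _ _ _ (fun x => form A (vec x) (vec x)) g); first exact: cform.
  by apply: hg; exists (vec x).
have [x /set_mem Sx hx] := compact_EVT_max S0 cS cg.
exists (form A (vec x) (vec x)); first by exists (vec x).
move=> _ [y y1 <-]; have [t ht] := vecP y.
by rewrite -ht; apply: hx; apply/mem_set; rewrite /S /= ht.
Qed.

Lemma ReB (x y : R[i]) : complex.Re (x - y) = complex.Re x - complex.Re y.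
Proof. by case: x; case: y. Qed.

Lemma ReZ (s : R) (x : R[i]) : complex.Re (s%:C%C * x) = s * complex.Re x.
Proof. by case: x => a b /=; rewrite mul0r subr0. Qed.

(** Separation. If [z] were outside the range, let [q] be a point of the range nearest to [z]. The
    direction from [q] to [z] provides a point [p] of the range at least as far along as [z], and
    the segment from [q] to [p] comes closer to [z]. *)
Lemma disk_sub_num_range (C0 : R[i]) (rho : R) :
  (forall e : R[i], `|e| = 1 -> exists2 y : 'I_n -> R[i], sqnorm y != 0 &
     (complex.Re (e^* * C0) + rho) * complex.Re (sqnorm y) <=
       complex.Re (e^* * form A y y)) ->
  forall z, `|z - C0| <= rho%:C%C -> num_range A z.
Proof.
move=> he z hz.
have dir e : `|e| = 1 -> exists2 v, num_range A v & complex.Re (e^* * C0) + rho <= complex.Re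
  (e^* * v).
  move=> e1; have [y y0 hy] := he e e1.
  have s0 : 0 < sqnorm y by rewrite lt_def y0 sqnorm_ge0.
  have [s hs] := complex_realP _ (ger0_real (sqnorm_ge0 y)).
  have s0' : 0 < s by rewrite -ltcR -hs.
  exists (form A y y / sqnorm y); first by apply: (num_rangeI y0); rewrite divfK.
  rewrite -(ler_pM2r s0'); move: hy; rewrite hs /=; move/le_trans; apply.
  rewrite mulrA -rmorphV ?unitfE ?gt_eqF //.
  by case: (e^* * form A y y) => a b /=; rewrite mulr0 subr0 divfK // gt_eqF.
have ne : num_range A !=set0 by have [v hv _] := dir 1 (normr1 _); exists v.
pose g (w : R[i]) : R := - ComplexField.Normc.normc (z - w).
have [x x0|q hq hmax] := @num_range_max g ne.
  apply: normc_continuousN; apply: continuous_addC; first exact: cst_continuous.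
  by move=> u; apply: continuousN.
have [->//|zq] := eqVneq z q.
have d0 : `|z - q| != 0 by rewrite normr_eq0 subr_eq0.
pose e := (z - q) / `|z - q|.
have e1 : `|e| = 1 by rewrite normrM normfV normr_id divff.
have [p hp hpe] := dir e e1.
have n2 (x : R[i]) : ComplexField.Normc.normc x ^+ 2 = complex.Re x ^+ 2 + complex.Im x ^+ 2.
  by case: x => a b /=; rewrite sqr_sqrtr // addr_ge0 ?sqr_ge0.
pose m := complex.Re ((z - q)^* * (p - q)).
pose D := ComplexField.Normc.normc (z - q); pose P := ComplexField.Normc.normc (p - q).
have D0 : 0 < D by rewrite -ltcR /D -norm_normc lt_def d0 normr_ge0.
have hm : D ^+ 2 <= m.
  have hzq : z - q = D%:C%C * e by rewrite /D -norm_normc /e mulrCA mulfV // mulr1.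
  have hrz : complex.Re (e^* * z) <= complex.Re (e^* * C0) + rho.
    rewrite -lerBlDl -ReB -mulrBr; apply: le_trans (ler_norm _) _; rewrite -lecR.
    by apply: le_trans (normc_ge_Re _) _; rewrite normrM norm_conjC e1 mul1r.
  have hre : complex.Re (e^* * (z - q)) <= complex.Re (e^* * (p - q)).
    by rewrite !mulrBr !ReB lerD2r; exact: le_trans hrz hpe.
  have hee : complex.Re (e^* * (z - q)) = D.
    by rewrite hzq mulrCA -normCKC e1 expr1n mulr1.
  rewrite /m hzq conjME [D%:C%C^*]conj_Creal ?complex_real // -mulrA ReZ expr2.
  by apply: ler_wpM2l; [exact: ltW|rewrite -[leLHS]hee].
have P0 : 0 <= P ^+ 2 by rewrite sqr_ge0.
have m0 : 0 < m by apply: lt_le_trans hm; exact: exprn_gt0.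
have sum0 : 0 < m + P ^+ 2 by rewrite ltr_wpDr.
(* The squared distance to [z] along the segment is [D^2 - 2 t m + t^2 P^2]. Its minimizer [m / P^2]
   may exceed [1]; this [t] does not, and still decreases it. *)
pose t := m / (m + P ^+ 2).
have t0 : 0 < t by rewrite divr_gt0.
have t01 : 0 <= t <= 1.
  by rewrite (ltW t0) ler_pdivrMr // mul1r lerDl.
have := hmax _ (num_range_convex hp hq t01).
rewrite /g lerN2 -/D => h.
have : D ^+ 2 <= D ^+ 2 - 2 * t * m + t ^+ 2 * P ^+ 2.
  apply: (@le_trans _ _ (ComplexField.Normc.normc (z - (q + t%:C%C * (p - q))) ^+ 2)).
    by rewrite lerXn2r // nnegrE ?(ltW D0) // (le_trans (ltW D0)).
  rewrite opprD addrA /D /P /m; move: (t) (z - q) (p - q) => s [a b] [a' b'].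
  by rewrite !n2 /= le_eqVlt; apply/orP; left; apply/eqP; ring.
have e3 : t * P ^+ 2 = m - t * m.
  by rewrite /t; field; rewrite gt_eqF.
have -> : t ^+ 2 * P ^+ 2 = t * (m - t * m) by rewrite -e3; ring.
have := addr_gt0 (mulr_gt0 t0 m0) (mulr_gt0 t0 (mulr_gt0 t0 m0)).
by rewrite mulrBr; lra.
Qed.

End NumericalRange.

(** * Trial vectors *)

Section TrialBounds.
Variable R : realType.

(** Here [y] is [|c|^2] and [u] the real part of [c * e^*]. The left side is the support function of
    the pseudohyperbolic disk times the squared norm [4] of the trial vector, the right side the
    value of the form at that vector. Equality holds at [c = 0], and the terms of first order in [c]
    force [k = 3 / 2] there. *)
Lemma trial_bound3 (s u y k r : R) : s ^+ 2 = 2 -> 0 < s -> 0 <= y -> y < 1 -> u ^+ 2 <= y ->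
  k = (3 + y) / (2 + 2 * y) -> r = s / 2 ->
  (((1 - r ^+ 2) / (1 - k ^+ 2 * y * r ^+ 2)) * k * u + r * (1 - k ^+ 2 * y) / (1 -
    k ^+ 2 * y * r ^+ 2)) * 4
   <= 4 * u + (1 - y) * (2 * s - u).
Proof.
move=> s2 s0 y0 y1 uy kE rE.
pose D := 4 * (1 + y) ^+ 2 - y * (3 + y) ^+ 2 / 2.
have D0 : 0 < D by rewrite /D; nra.
have r2 : r ^+ 2 = 2^-1 by rewrite rE exprMn s2 exprVn; field.
have y22 : 2 + 2 * y != 0 by apply: lt0r_neq0; lra.
have dE : 1 - k ^+ 2 * y * r ^+ 2 = D / (2 + 2 * y) ^+ 2.
  by rewrite r2 kE /D; field; exact: y22.
have eD : D != 0 by exact: lt0r_neq0.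
rewrite dE r2.
have -> : (1 - 2^-1) / (D / (2 + 2 * y) ^+ 2) * k * u + r * (1 -
  k ^+ 2 * y) / (D / (2 + 2 * y) ^+ 2) =
   ((1 + y) * (3 + y) * u + r * (1 - y) * (4 + 3 * y + y ^+ 2)) / D.
  by rewrite kE; field; rewrite eD y22.
rewrite mulrAC ler_pdivrMr // rE -subr_ge0.
have -> : (4 * u + (1 - y) * (2 * s - u)) * D - ((1 + y) * (3 + y) * u + s / 2 * (1 -
  y) * (4 + 3 * y + y ^+ 2)) * 4 =
   y * (1 - y) ^+ 2 * (s * (1 + y) - u * (3 + y) / 2).
  by rewrite /D; field.
apply: mulr_ge0; first by rewrite mulr_ge0 // sqr_ge0.
have s1 : 1 <= s by rewrite -(ler_sqr (x := 1)) ?nnegrE ?ltW // s2 expr1n; lra.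
have u1 : u <= (1 + y) / 2 by have := sqr_ge0 (u - 1); rewrite sqrrB expr1n; lra.
have h1 : 0 <= (3 + y) / 2 by lra.
have h2 : 0 <= 1 + y by lra.
have h3 := ler_wpM2r h1 u1; have h4 := ler_wpM2r h2 s1.
have h5 : 0 <= (1 - y) * (1 + y) by rewrite mulr_ge0 //; lra.
lra.
Qed.

(* The three polynomials are the coefficients, as polynomials in [m], of the quantity to be
   bounded in [trial_bound4]; they are positive combinations of Bernstein polynomials. *)
Lemma trial4_coef0 (u r : R) : r = 27 / 34 -> -1 <= u -> u <= 1 ->
  33 / 10 <= ((2 + u ^+ 2) ^+ 2 - 9 * u ^+ 2 * r ^+ 2) * (55 - 30 * u + 9 * u ^+ 2) -
    68 * (r * (4 - u ^+ 2) - (6 * r ^+ 2 - 2 - u ^+ 2) * u).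
Proof.
move=> -> u0 u1.
have bern (a b : R) i j : a <= u -> u <= b -> 0 <= (u - a) ^+ i * (b - u) ^+ j.
  by move=> au ub; rewrite mulr_ge0 ?exprn_ge0 ?subr_ge0.
(* Subdividing sharpens the Bernstein lower bounds. There is little room: the value is [4] at
   [u = 0], and [2 / 3] is close to the minimizer on [[-1, 1]]. *)
have [h|/ltW h] := lerP u 0.
  have := bern _ _ 0%N 6%N u0 h; have := bern _ _ 1%N 5%N u0 h; have := bern _ _ 2%N 4%N u0 h.
  have := bern _ _ 3%N 3%N u0 h; have := bern _ _ 4%N 2%N u0 h; have := bern _ _ 5%N 1%N u0 h.
  have := bern _ _ 6%N 0%N u0 h; lra.
have [k|/ltW k] := lerP u (2 / 3).
  have := bern _ _ 0%N 6%N h k; have := bern _ _ 1%N 5%N h k; have := bern _ _ 2%N 4%N h k.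
  have := bern _ _ 3%N 3%N h k; have := bern _ _ 4%N 2%N h k; have := bern _ _ 5%N 1%N h k.
  have := bern _ _ 6%N 0%N h k; lra.
have := bern _ _ 0%N 6%N k u1; have := bern _ _ 1%N 5%N k u1; have := bern _ _ 2%N 4%N k u1.
have := bern _ _ 3%N 3%N k u1; have := bern _ _ 4%N 2%N k u1; have := bern _ _ 5%N 1%N k u1.
have := bern _ _ 6%N 0%N k u1; lra.
Qed.

Lemma trial4_coef1 (u r : R) : r = 27 / 34 -> -1 <= u -> u <= 1 ->
  -29 <= ((2 + u ^+ 2) ^+ 2 - 9 * u ^+ 2 * r ^+ 2) * (80 - 30 * u - 25 * u ^+ 2) +
    (2 * (2 + u ^+ 2) - 9 * r ^+ 2) * (55 - 30 * u + 9 * u ^+ 2) -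
    68 * (r * (4 - u ^+ 2) - (6 * r ^+ 2 - 2 - u ^+ 2) * u + u - r).
Proof.
move=> -> u0 u1.
have bern i j : 0 <= (u + 1) ^+ i * (1 - u) ^+ j.
  by rewrite mulr_ge0 ?exprn_ge0 ?subr_ge0 -?lerBlDr ?sub0r.
have := bern 0%N 6%N; have := bern 1%N 5%N; have := bern 2%N 4%N; have := bern 3%N 3%N.
have := bern 4%N 2%N; have := bern 5%N 1%N; have := bern 6%N 0%N; lra.
Qed.

Lemma trial4_coef2 (u r : R) : r = 27 / 34 -> -1 <= u -> u <= 1 ->
  70 <= 25 * ((2 + u ^+ 2) ^+ 2 - 9 * u ^+ 2 * r ^+ 2) +
    (2 * (2 + u ^+ 2) - 9 * r ^+ 2) * (80 - 30 * u - 25 * u ^+ 2) +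
    (55 - 30 * u + 9 * u ^+ 2) - 68 * (u - r).
Proof.
move=> -> u0 u1.
have bern (a b : R) i j : a <= u -> u <= b -> 0 <= (u - a) ^+ i * (b - u) ^+ j.
  by move=> au ub; rewrite mulr_ge0 ?exprn_ge0 ?subr_ge0.
have [h|/ltW h] := lerP u (1 / 6).
  have := bern _ _ 0%N 4%N u0 h; have := bern _ _ 1%N 3%N u0 h; have := bern _ _ 2%N 2%N u0 h.
  have := bern _ _ 3%N 1%N u0 h; have := bern _ _ 4%N 0%N u0 h; lra.
have := bern _ _ 0%N 4%N h u1; have := bern _ _ 1%N 3%N h u1; have := bern _ _ 2%N 2%N h u1.
have := bern _ _ 3%N 1%N h u1; have := bern _ _ 4%N 0%N h u1; lra.
Qed.

(** The quadratic [33/10 - 29 m + 70 m^2] has negative discriminant [841 - 924]; its minimizer is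
    [29 / 140]. *)
Lemma quartic_ge0 (a0 a1 a2 a3 m : R) :
  33 / 10 <= a0 -> -29 <= a1 -> 70 <= a2 -> 0 <= a3 -> 0 <= m ->
  0 <= a0 + a1 * m + a2 * m ^+ 2 + a3 * m ^+ 3 + 25 * m ^+ 4.
Proof.
move=> h0 h1 h2 h3 m0.
have k1 := ler_wpM2r m0 h1; have k2 := ler_wpM2r (sqr_ge0 m) h2.
have k3 := mulr_ge0 h3 (exprn_ge0 3 m0); have k4 := exprn_ge0 4 m0.
have := sqr_ge0 (m - 29 / 140); rewrite sqrrB; lra.
Qed.

(** Here [m] is the squared imaginary part of [c * e^*], and [68 * (1 + m)] the squared norm of the
    trial vector. Apart from a factor [1 - y], the difference with cleared denominators is a quartic
    in [m] whose coefficients depend only on [u] in [[-1, 1]]. *)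
Lemma trial_bound4 (u m y k r : R) : 0 <= m -> y = u ^+ 2 + m -> y < 1 ->
  k = 3 / (2 + y) -> r = 27 / 34 ->
  (((1 - r ^+ 2) / (1 - k ^+ 2 * y * r ^+ 2)) * k * u + r * (1 - k ^+ 2 * y) / (1 -
    k ^+ 2 * y * r ^+ 2)) * (68 * (1 + m))
   <= u * (68 * (1 + m)) + (1 - y) * ((1 + m) * (55 + 25 * m - 30 * u) + u ^+ 2 * (9 - 25 * m)).
Proof.
move=> m0 yE y1 kE rE.
have y0 : 0 <= y by rewrite yE addr_ge0 ?sqr_ge0.
pose D := (2 + y) ^+ 2 - 9 * y * r ^+ 2.
have D0 : 0 < D by rewrite /D rE; nra.
have y22 : 2 + y != 0 by apply: lt0r_neq0; lra.
have dE : 1 - k ^+ 2 * y * r ^+ 2 = D / (2 + y) ^+ 2 by rewrite kE /D; field; exact: y22.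
have eD : D != 0 by exact: lt0r_neq0.
rewrite dE.
have -> : (1 - r ^+ 2) / (D / (2 + y) ^+ 2) * k * u + r * (1 - k ^+ 2 * y) / (D / (2 + y) ^+ 2) =
   (3 * (2 + y) * (1 - r ^+ 2) * u + r * (1 - y) * (4 - y)) / D.
  by rewrite kE; field; rewrite eD y22.
rewrite mulrAC ler_pdivrMr // -subr_ge0.
pose q := (1 + m) * (55 + 25 * m - 30 * u) + u ^+ 2 * (9 - 25 * m).
have -> : (u * (68 * (1 + m)) + (1 - y) * ((1 + m) * (55 + 25 * m - 30 * u) + u ^+ 2 * (9 -
  25 * m))) * D -
   (3 * (2 + y) * (1 - r ^+ 2) * u + r * (1 - y) * (4 - y)) * (68 * (1 + m)) =
   (1 - y) * (D * q - 68 * (1 + m) * (r * (4 - y) - (6 * r ^+ 2 - 2 - y) * u)).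
  by rewrite /D /q; ring.
apply: mulr_ge0; first lra.
have u21 : u ^+ 2 <= 1 by rewrite yE in y1; lra.
have ul : -1 <= u by nra.
have uu : u <= 1 by nra.
have key : D * q - 68 * (1 + m) * (r * (4 - y) - (6 * r ^+ 2 - 2 - y) * u) =
  (((2 + u ^+ 2) ^+ 2 - 9 * u ^+ 2 * r ^+ 2) * (55 - 30 * u + 9 * u ^+ 2) -
    68 * (r * (4 - u ^+ 2) - (6 * r ^+ 2 - 2 - u ^+ 2) * u)) +
  (((2 + u ^+ 2) ^+ 2 - 9 * u ^+ 2 * r ^+ 2) * (80 - 30 * u - 25 * u ^+ 2) +
    (2 * (2 + u ^+ 2) - 9 * r ^+ 2) * (55 - 30 * u + 9 * u ^+ 2) -
    68 * (r * (4 - u ^+ 2) - (6 * r ^+ 2 - 2 - u ^+ 2) * u + u - r)) * m +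
  (25 * ((2 + u ^+ 2) ^+ 2 - 9 * u ^+ 2 * r ^+ 2) +
    (2 * (2 + u ^+ 2) - 9 * r ^+ 2) * (80 - 30 * u - 25 * u ^+ 2) +
    (55 - 30 * u + 9 * u ^+ 2) - 68 * (u - r)) * m ^+ 2 +
  (25 * (2 * (2 + u ^+ 2) - 9 * r ^+ 2) + (80 - 30 * u - 25 * u ^+ 2)) * m ^+ 3 + 25 * m ^+ 4.
  by rewrite /D /q yE; ring.
rewrite key.
have c0 := trial4_coef0 rE ul uu; have c1 := trial4_coef1 rE ul uu.
have c2 := trial4_coef2 rE ul uu.
have c3 : 0 <= 25 * (2 * (2 + u ^+ 2) - 9 * r ^+ 2) + (80 - 30 * u - 25 * u ^+ 2).
  by rewrite rE; nra.
exact: quartic_ge0.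
Qed.

End TrialBounds.

(** * Pseudohyperbolic disks as euclidean disks *)

Section PseudoDisk.
Variable R : realType.

(** The difference is a real multiple of [w] times a quotient of two conjugate numbers, so its
    modulus is constant on the circle. *)
Lemma pseudodisk_euclidean (p w : R[i]) (q r : R) :
  `|p| ^+ 2 = q%:C%C -> q < 1 -> 0 <= r -> r < 1 -> `|w| = r%:C%C ->
  `|(w + p) / (1 + p^* * w) - ((1 - r ^+ 2) / (1 - q * r ^+ 2))%:C%C * p|
     <= (r * (1 - q) / (1 - q * r ^+ 2))%:C%C.
Proof.
move=> hp q1 r0 r1 hw.
have q0 : 0 <= q by rewrite -lecR -hp exprn_ge0.
have r21 : r ^+ 2 < 1 by rewrite exprn_ilt1.
have d0 : 0 < 1 - q * r ^+ 2.
  by rewrite subr_gt0; apply: le_lt_trans q1; rewrite ler_piMr // ltW.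
have dc : (1 - q * r ^+ 2)%:C%C != 0 :> R[i] by rewrite fmorph_eq0 gt_eqF.
have hpp : p * p^* = q%:C%C by rewrite -normCK.
have hww : w * w^* = (r ^+ 2)%:C%C by rewrite -normCK hw rmorphXn.
have n0 : 1 + p^* * w != 0.
  apply/negP => /eqP /(congr1 (fun x => x - 1)); rewrite addrC addKr sub0r => h.
  have : `|p^* * w| ^+ 2 = 1 by rewrite h normrN1 expr1n.
  rewrite normrM norm_conjC exprMn hp hw -rmorphXn -rmorphM -[1]/(1%:C%C) => -[] h2.
  by move: d0; rewrite h2 subrr ltxx.
have -> : (w + p) / (1 + p^* * w) - ((1 - r ^+ 2) / (1 - q * r ^+ 2))%:C%C * p =
    ((1 - q) / (1 - q * r ^+ 2))%:C%C * (w * (1 + p * w^*) / (1 + p^* * w)).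
  apply: (mulIf n0); apply: (mulIf dc).
  have e (s : R) : (s / (1 - q * r ^+ 2))%:C%C * (1 - q * r ^+ 2)%:C%C = s%:C%C :> R[i].
    by rewrite -rmorphM divfK // gt_eqF.
  have e1 := e (1 - r ^+ 2); have e2 := e (1 - q).
  move: e1 e2; move: ((1 - r ^+ 2) / _)%:C%C ((1 - q) / _)%:C%C => al be e1 e2.
  transitivity ((w + p) * (1 - q * r ^+ 2)%:C%C -
     p * (1 + p^* * w) * (al * (1 - q * r ^+ 2)%:C%C)).
    by move: (_%:C%C) => d; field.
  transitivity (be * (1 - q * r ^+ 2)%:C%C * (w * (1 + p * w^*))); last first.
    by move: (_%:C%C) => d; field.
  have h1 : (1 - q * r ^+ 2)%:C%C = 1 - (p * p^*) * (w * w^*) by rewrite hpp hww rmorphB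
    rmorphM rmorph1.
  have h2 : (1 - r ^+ 2)%:C%C = 1 - w * w^* by rewrite hww rmorphB rmorph1.
  have h3 : (1 - q)%:C%C = 1 - p * p^* by rewrite hpp rmorphB rmorph1.
  rewrite e1 e2 h1 h2 h3; ring.
rewrite !normrM normfV.
have -> : `|1 + p * w^*| = `|1 + p^* * w|.
  by rewrite -(norm_conjC (1 + p * w^*)) !conjE conjCK.
rewrite mulfK ?normr_eq0 // hw norm_real_complex ger0_norm; last first.
  by rewrite divr_ge0 ?(ltW d0) // subr_ge0 ltW.
by rewrite -rmorphM lecR mulrC mulrA.
Qed.

End PseudoDisk.

Section Trial.
Variable R : realType.
Implicit Types (c e : R[i]).

(** This is [(N + c) (1 + c^* N)^-1] for the nilpotent Jordan block [N] with ones below the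
    diagonal. *)
Definition shift_mx c n : 'I_n -> 'I_n -> R[i] := fun i j => (shift_coef c i j)^*.

Lemma qformE c n (y : 'I_n -> R[i]) : qform c y = form (shift_mx c (n := n)) y y.
Proof. by []. Qed.

(* Multiplying the [i]-th coordinate by [e ^- i] turns the direction [e] into the direction
   [1], so that only [c / e] enters the estimates. *)
Lemma trial3 c e (g0 g1 g2 : R[i]) : `|e| = 1 ->
  exists y : 'I_3 -> R[i],
  sqnorm y = `|g0| ^+ 2 + `|g1| ^+ 2 + `|g2| ^+ 2 /\
  e^* * form (shift_mx c (n := 3)) y y =
    c * e^* * sqnorm y +
    (1 - `|c| ^+ 2) * (g0 * g1^* + g1 * g2^* - (c * e^*)^* * (g0 * g2^*)).
Proof.
move=> e1; have ee : e * e^* = 1 by rewrite -normCK e1 expr1n.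
exists (fun i => e^* ^+ i * [:: g0; g1; g2]`_i).
have hN : sqnorm (fun i : 'I_3 => e^* ^+ i * [:: g0; g1;
  g2]`_i) = `|g0| ^+ 2 + `|g1| ^+ 2 + `|g2| ^+ 2.
  rewrite /sqnorm !big_ord_recl big_ord0 /= !normrM !normrX norm_conjC e1 !expr1n !mul1r.
  by rewrite addr0 addrA.
split=> //; rewrite hN /form /shift_mx !big_ord_recl !big_ord0 /= /bump /=.
rewrite !conjE ?conjCK !normCK.
have en0 : e != 0 by rewrite -normr_eq0 e1 oner_eq0.
have -> : e^* = e^-1 by apply: (mulfI en0); rewrite ee divff.
by field.
Qed.

Lemma trial4 c e (g0 g1 g2 g3 : R[i]) : `|e| = 1 ->
  exists y : 'I_4 -> R[i],
  sqnorm y = `|g0| ^+ 2 + `|g1| ^+ 2 + `|g2| ^+ 2 + `|g3| ^+ 2 /\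
  e^* * form (shift_mx c (n := 4)) y y =
    c * e^* * sqnorm y +
    (1 - `|c| ^+ 2) * (g0 * g1^* + g1 * g2^* + g2 * g3^* -
      (c * e^*)^* * (g0 * g2^* + g1 * g3^*) + (c * e^*)^* ^+ 2 * (g0 * g3^*)).
Proof.
move=> e1; have ee : e * e^* = 1 by rewrite -normCK e1 expr1n.
exists (fun i => e^* ^+ i * [:: g0; g1; g2; g3]`_i).
have hN : sqnorm (fun i : 'I_4 => e^* ^+ i * [:: g0; g1; g2; g3]`_i) =
    `|g0| ^+ 2 + `|g1| ^+ 2 + `|g2| ^+ 2 + `|g3| ^+ 2.
  rewrite /sqnorm !big_ord_recl big_ord0 /= !normrM !normrX norm_conjC e1 !expr1n !mul1r.
  by rewrite addr0 !addrA.
split=> //; rewrite hN /form /shift_mx !big_ord_recl !big_ord0 /= /bump /=.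
rewrite !conjE ?conjCK !normCK.
have en0 : e != 0 by rewrite -normr_eq0 e1 oner_eq0.
have -> : e^* = e^-1 by apply: (mulfI en0); rewrite ee divff.
by field.
Qed.

End Trial.

(** * The maximum of a Blaschke product on the numerical range *)

Section Final.
Variable R : realType.
Implicit Types (c e z : R[i]).

Section Pointwise.
Variables (T : topologicalType) (f g : T -> R[i]) (x : T).
Hypotheses (hf : {for x, continuous f}) (hg : {for x, continuous g}).

Lemma continuous_atM : {for x, continuous (fun t => f t * g t)}.
Proof. by apply: cvgM; [exact: hf|exact: hg]. Qed.

Lemma continuous_atB : {for x, continuous (fun t => f t - g t)}.
Proof. by apply: cvgB; [exact: hf|exact: hg]. Qed.

Lemma continuous_atV : f x != 0 -> {for x, continuous (fun t => (f t)^-1)}.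
Proof. by move=> fx; apply: cvgV; [exact: fx|exact: hf]. Qed.

End Pointwise.

Lemma continuous_moebius (a z : R[i]) : `|a| < 1 -> `|z| <= 1 ->
  {for z, continuous (moebius a)}.
Proof.
move=> a1 z1; have nz : 1 - a^* * z != 0.
  rewrite subr_eq0; apply/negP => /eqP h; have : `|a^* * z| = 1 by rewrite -h normr1.
  rewrite normrM norm_conjC => h2.
  have : `|a| * `|z| < 1 by apply: le_lt_trans a1; exact: ler_piMr.
  by rewrite h2 ltxx.
have hc (k : R[i]) : {for z, continuous (fun=> k)} by exact: cst_continuous.
have hi : {for z, continuous (fun t : R[i] => t)} by exact: cvg_id.
apply: continuous_atM; first exact: continuous_atB hi (hc a).
have h1 : {for z, continuous (fun t : R[i] => 1 - a^* * t)}.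
  exact: (continuous_atB (hc 1) (continuous_atM (hc a^*) hi)).
exact: (continuous_atV h1 nz).
Qed.

Lemma continuous_blaschke (B : finite_blaschke R) z : `|z| <= 1 -> {for z, continuous B}.
Proof.
move=> z1; apply: continuous_atM; first exact: cst_continuous.
have := @fb_zerosP R B; elim: (fb_zeros B) => [|a s IHs] hs.
  rewrite (_ : (fun x => _) = (fun=> 1)); first exact: cst_continuous.
  by apply/funext => x; rewrite big_nil.
rewrite (_ : (fun x => _) = (fun x => moebius a x * \prod_(b <- s) moebius b x)).
  apply: continuous_atM; first by apply: continuous_moebius => //; apply: hs; rewrite mem_head.
  by apply: IHs => b bs; apply: hs; rewrite in_cons bs orbT.
by apply/funext => x; rewrite big_cons.
Qed.

Lemma blaschke_max c n (B : finite_blaschke R) (p : R[i]) (r : R) :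
  `|c| < 1 -> (fb_deg B < n)%N -> `|p| < 1 -> 0 < r < 1 -> 2^-1 <= r ^+ n.-1 ->
  (forall w, `|w| = r%:C%C -> num_range (shift_mx c (n := n)) ((w + p) / (1 + p^* * w))) ->
  exists m : R[i], is_max [set `|B z| | z in num_range (shift_mx c (n := n))] m /\ 2^-1 <= m.
Proof.
move=> c1 Bn p1 r01 rn hw; have [r0 r1] := andP r01.
have ne : num_range (shift_mx c (n := n)) !=set0.
  exists ((r%:C%C + p) / (1 + p^* * r%:C%C)); apply: hw.
  by rewrite norm_real_complex ger0_norm // ltW.
have hle z : num_range (shift_mx c (n := n)) z -> `|z| <= 1.
  by move=> [y y1 <-]; rewrite -qformE; exact: qform_norm_le1.
have [z0 z0W z0m] := @num_range_max R n _ (fun z => ComplexField.Normc.normc (B z)) ne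
  (fun z zW => normc_continuous (@continuous_blaschke B z (hle z zW))).
have hmax z : num_range (shift_mx c (n := n)) z -> `|B z| <= `|B z0|.
  by move=> zW; rewrite !norm_normc lecR; exact: z0m.
exists `|B z0|; split; first split; first by exists z0.
  by move=> _ [z zW <-]; exact: hmax.
have h := @blaschke_pseudodisk_bound R (fb_zeros B) p `|B z0| r (@fb_zerosP R B) p1 r01.
have {}h : (r ^+ fb_deg B)%:C%C <= `|B z0|.
  apply: h => w wr; apply: le_trans (hmax _ (hw w wr)).
  by rewrite /fb_fun normrM fb_constP mul1r normr_prod.
apply: le_trans h; apply: (@le_trans _ _ (r ^+ n.-1)%:C%C).
  by move: rn; rewrite -lecR fmorphV rmorph_nat.
rewrite lecR; apply: ler_wiXn2l; rewrite ?(ltW r0) ?(ltW r1) //.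
by rewrite -ltnS (ltn_predK Bn).
Qed.

(** The hypothesis compares, in direction [e], the support function of the euclidean disk given by
    [pseudodisk_euclidean] for [p = k c] with the form at a single vector. *)
Lemma pseudodisk_sub_num_range c n (k r : R) :
  `|c| < 1 -> 0 <= r -> r < 1 -> 
  let y := complex.Re (`|c| ^+ 2) in
  k ^+ 2 * y < 1 ->
  (forall e, `|e| = 1 -> let u := complex.Re (c * e^*) in
     exists2 v : 'I_n -> R[i], sqnorm v != 0 &
     (((1 - r ^+ 2) / (1 - k ^+ 2 * y * r ^+ 2)) * k * u +
        r * (1 - k ^+ 2 * y) / (1 - k ^+ 2 * y * r ^+ 2)) * complex.Re (sqnorm v)
     <= complex.Re (e^* * form (shift_mx c (n := n)) v v)) ->
  forall w, `|w| = r%:C%C ->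
  num_range (shift_mx c (n := n)) ((w + k%:C%C * c) / (1 + (k%:C%C * c)^* * w)).
Proof.
move=> c1 r0 r1 y ky he w wr.
have hy : `|c| ^+ 2 = y%:C%C by rewrite RRe_real // normrX_real.
have hp : `|k%:C%C * c| ^+ 2 = (k ^+ 2 * y)%:C%C.
  by rewrite normrM exprMn hy norm_real_complex -rmorphXn -rmorphM /= real_normK // num_real.
have := pseudodisk_euclidean hp ky r0 r1 wr.
apply: disk_sub_num_range => e e1; have [v v0 hv] := he e e1; exists v => //.
rewrite -[X in complex.Re X](_ : ((1 - r ^+ 2) / (1 -
  k ^+ 2 * y * r ^+ 2) * k)%:C%C * (c * e^*) = _); last first.
  by rewrite rmorphM; ring.
by rewrite ReZ.
Qed.

End Final.

(** * Degrees three and four *)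

Section Degrees.
Variable R : realType.
Implicit Types (c e : R[i]).

Lemma conj_Complex (a b : R) : (Complex a b)^* = Complex a (- b) :> R[i].
Proof. by []. Qed.

Lemma normsq_Complex (a b : R) : `|Complex a b| ^+ 2 = (a ^+ 2 + b ^+ 2)%:C%C :> R[i].
Proof. by rewrite -add_Re2_Im2. Qed.

Lemma normsq_lt1 c : `|c| < 1 ->
  [/\ `|c| ^+ 2 = (complex.Re (`|c| ^+ 2))%:C%C, 0 <= complex.Re (`|c| ^+ 2) &
    complex.Re (`|c| ^+ 2) < 1].
Proof.
move=> c1; have e : `|c| ^+ 2 = (complex.Re (`|c| ^+ 2))%:C%C by rewrite RRe_real // normrX_real.
split=> //; first by rewrite -lecR -e exprn_ge0.
by rewrite -ltcR -e exprn_ilt1.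
Qed.

Lemma rotated c e : `|e| = 1 -> exists v : R,
  c * e^* = Complex (complex.Re (c * e^*)) v /\
  complex.Re (`|c| ^+ 2) = complex.Re (c * e^*) ^+ 2 + v ^+ 2.
Proof.
move=> e1; exists (complex.Im (c * e^*)); split; first by case: (c * e^*).
by rewrite -(mulr1 `|c|) -e1 -(norm_conjC e) -normrM -add_Re2_Im2.
Qed.

Lemma scaled_lt1 c (k : R) : k ^+ 2 * complex.Re (`|c| ^+ 2) < 1 -> `|c| < 1 -> `|k%:C%C * c| < 1.
Proof.
move=> h c1; have [hy _ _] := normsq_lt1 c1.
rewrite -(ltr_pXn2r (n := 2)) ?nnegrE // expr1n normrM exprMn hy norm_real_complex.
by rewrite -rmorphXn -rmorphM real_normK ?num_real // -[1]/(1%:C%C) ltcR.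
Qed.

Lemma blaschke_max3 c (B : finite_blaschke R) : `|c| < 1 -> (fb_deg B < 3)%N ->
  exists m : R[i], is_max [set `|B z| | z in num_range (shift_mx c (n := 3))] m /\ 2^-1 <= m.
Proof.
move=> c1 hB; have [hy y0 y1] := normsq_lt1 c1; set y := complex.Re _ in hy y0 y1.
pose s : R := Num.sqrt 2; have s2 : s ^+ 2 = 2 by rewrite sqr_sqrtr.
have s0 : 0 < s by rewrite sqrtr_gt0.
(* [k * c] approximates the pseudohyperbolic center of the euclidean disk that the trial
   vectors exhibit in the numerical range. *)
pose k := (3 + y) / (2 + 2 * y); pose r := s / 2.
have r2 : r ^+ 2 = 2^-1 by rewrite /r exprMn s2; field.
have r0 : 0 < r by rewrite divr_gt0.
have r1 : r < 1 by rewrite -(ltr_pXn2r (n := 2)) ?nnegrE ?(ltW r0) // r2 expr1n invf_lt1 // ltr1n.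
have ky : k ^+ 2 * y < 1.
  rewrite /k exprMn exprVn mulrAC ltr_pdivrMr ?exprn_gt0 //; last lra.
  have : 0 < (1 - y) * (4 + 3 * y + y ^+ 2) by rewrite mulr_gt0 ?subr_gt0 // !ltr_wpDr
    ?mulr_ge0 ?sqr_ge0.
  lra.
apply: (@blaschke_max R c 3 B (k%:C%C * c) r) => //; first exact: scaled_lt1.
- by rewrite r0 r1.
- by rewrite r2.
apply: pseudodisk_sub_num_range => //; first exact: ltW.
move=> e e1 u; have [v [hv yuv]] := rotated c e1; rewrite -/u -/y in hv yuv.
(* [(1, s, 1)] is the top eigenvector of the real part of the Jordan block, with eigenvalue [1 / s];
   it is exact at [c = 0], where no loss is allowed. *)
have [w [hN hF]] := trial3 c 1 s%:C%C 1 e1.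
have {}hN : sqnorm w = 4%:C%C.
  rewrite hN normr1 expr1n norm_real_complex -rmorphXn /= real_normK ?num_real // s2.
  by rewrite -[1]/(1%:C%C) -!rmorphD; congr (_%:C%C); ring.
exists w; first by rewrite hN fmorph_eq0 pnatr_eq0.
rewrite hF hN hv hy.
have -> : complex.Re (Complex u v * 4%:C%C + (1 - y%:C%C) * (1 * s%:C%C^* + s%:C%C * 1^* -
  (Complex u v)^* * (1 * 1^*)))
   = 4 * u + (1 - y) * (2 * s - u).
  by rewrite !conj1E (conj_Complex s 0) (conj_Complex u v) /=; ring.
by apply: (trial_bound3 s2) => //; rewrite yuv lerDl sqr_ge0.
Qed.

Lemma blaschke_max4 c (B : finite_blaschke R) : `|c| < 1 -> (fb_deg B < 4)%N ->
  exists m : R[i], is_max [set `|B z| | z in num_range (shift_mx c (n := 4))] m /\ 2^-1 <= m.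
Proof.
move=> c1 hB; have [hy y0 y1] := normsq_lt1 c1; set y := complex.Re _ in hy y0 y1.
(* [r = 54 / 68] is just below the Rayleigh quotient [55 / 68] of [(3, 5, 5, 3)] at [c = 0], and
   [27^3 = 19683] just exceeds half of [34^3 = 39304]. For small [c], [k] near [3 / 2] puts the
   euclidean center near [0.554 c], close to the first order shift [38 / 68] seen by this vector. *)
pose k := 3 / (2 + y); pose r : R := 27 / 34.
have ky : k ^+ 2 * y < 1.
  rewrite /k exprMn exprVn mulrAC ltr_pdivrMr ?exprn_gt0 //; last lra.
  have : 0 < (1 - y) * (4 - y) by rewrite mulr_gt0 ?subr_gt0 //; lra.
  lra.
apply: (@blaschke_max R c 4 B (k%:C%C * c) r) => //; first exact: scaled_lt1.
- by rewrite /r; lra.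
- by rewrite /r; lra.
apply: pseudodisk_sub_num_range => //; [by rewrite /r; lra|by rewrite /r; lra|].
move=> e e1 u; have [v [hv yuv]] := rotated c e1; rewrite -/u -/y in hv yuv.
(* [(3, 5, 5, 3)] and [(5, 3, -3, -5)] approximate the two leading eigenvectors of the
   real part of the Jordan block, whose entries are in the golden ratio; the second one
   is the direction of the first order perturbation. *)
have [w [hN hF]] := trial4 c (Complex 3 (- (5 * v))) (Complex 5 (- (3 * v)))
  (Complex 5 (3 * v)) (Complex 3 (5 * v)) e1.
have {}hN : sqnorm w = (68 * (1 + v ^+ 2))%:C%C.
  by rewrite hN !normsq_Complex -!rmorphD; congr (_%:C%C); ring.
have N0 : 0 < 68 * (1 + v ^+ 2) by rewrite mulr_gt0 // ltr_wpDr ?sqr_ge0.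
exists w; first by rewrite hN fmorph_eq0 gt_eqF.
rewrite hF hN hv hy !conj_Complex [leRHS](_ : _ = u * (68 * (1 + v ^+ 2)) +
   (1 - y) * ((1 + v ^+ 2) * (55 + 25 * v ^+ 2 - 30 * u) + u ^+ 2 * (9 - 25 * v ^+ 2))); last first.
  by rewrite /=; ring.
by apply: trial_bound4 => //; exact: sqr_ge0.
Qed.

End Degrees.

Local Open Scope complex_scope.

Theorem corollary5p5 (R : realType) (Theta B : finite_blaschke R)
  (hdeg : (fb_deg B < fb_deg Theta)%N)
  (huni : unicritical Theta)
  (hTheta : fb_deg Theta = 3%N \/ fb_deg Theta = 4%N) :
  exists m : R[i],
    is_max [set `|B z| | z in
             numerical_range (model_space Theta) (compressed_shift Theta)] m /\
    2^-1 <= m.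
Proof.
have [_ [l [c [ln c1 hT]]]] := huni.
rewrite (numerical_rangeE ln c1 hT).
by case: hTheta => e; rewrite e in hdeg *; [exact: blaschke_max3|exact: blaschke_max4].
Qed.
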